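(* Let $r\in\mathbb{N}_0$ be fixed, and let $E_{n;r}$ and $V_{n;r}$ denote the expectation and variance of the number of $r$-branches of a binary tree chosen uniformly at random among all binary trees with $n$ inner nodes. Then, as $n\to\infty$, \[ E_{n;r}=\frac{n}{4^r}+\frac16\Big(1+\frac{5}{4^r}\Big)+\frac{1}{20n}\Big(4^r-\frac{1}{4^r}\Big)+\frac{1}{12n^2}\Big(\frac{5\cdot16^r}{21}-\frac{7\cdot4^r}{10}+\frac{97}{210\cdot4^r}\Big)+O(n^{-3}), \] \[ V_{n;r}=\frac{4^r-1}{3\cdot16^r}\,n-\frac{2\cdot16^r-25\cdot4^r+23}{90\cdot16^r}-\frac{13\cdot64^r-14\cdot16^r+7\cdot4^r-6}{420\cdot16^r\,n}+O(n^{-2}). \]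
   Context: A binary tree is either a leaf $\square$ or an inner node with an ordered pair of subtrees (left, right) which are binary trees; its size is its number of inner nodes. The register function is defined by $\mathrm{Reg}(\square)=0$, and for a tree with subtrees $t_1,t_2$: $\mathrm{Reg}(t)=\max\{\mathrm{Reg}(t_1),\mathrm{Reg}(t_2)\}$ if these differ, and $\mathrm{Reg}(t_1)+1$ otherwise. Label every node (inner node or leaf) of a tree $t$ by the register function of the subtree rooted at it. An $r$-branch of $t$ is a maximal chain of nodes labeled $r$, i.e. a connected component (with respect to the parent–child edges) of the set of nodes labeled $r$; such a component is always a path going downward from a node. The nodes of $t$ are partitioned into $r$-branches, $r\ge0$. *)

(* Defs.v *)
From Stdlib Require Import Reals List Arith.
Import ListNotations.
Open Scope R_scope.

Inductive btree : Type :=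
| Leaf : btree
| Node : btree -> btree -> btree.

Fixpoint bsize (t : btree) : nat :=
  match t with
  | Leaf => 0
  | Node t1 t2 => S (bsize t1 + bsize t2)
  end%nat.

Fixpoint Reg (t : btree) : nat :=
  match t with
  | Leaf => 0
  | Node t1 t2 =>
      let a := Reg t1 in let b := Reg t2 in
      if Nat.eqb a b then S a else Nat.max a b
  end%nat.

(* Number of r-branches of a subtree, given whether its root is attached to a
   parent that carries label r (so that the root, if labeled r, continues the
   parent's r-branch).  Each r-branch (connected component of nodes labeled r)
   is counted exactly once, at its topmost node: a node labeled r whose parent
   does not exist or is not labeled r. *)
Fixpoint branches_aux (r : nat) (parent_r : bool) (t : btree) : nat :=
  let here := Nat.eqb (Reg t) r in
  let start := (if here then (if parent_r then 0 else 1) else 0)%nat in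
  match t with
  | Leaf => start
  | Node t1 t2 => start + branches_aux r here t1 + branches_aux r here t2
  end%nat.

(* number of r-branches of t (all nodes, inner nodes and leaves, are labeled) *)
Definition branches (r : nat) (t : btree) : nat := branches_aux r false t.

(* all_upto n = [T_0; T_1; ...; T_n] where T_j lists every binary tree with
   exactly j inner nodes, each exactly once: a tree with m+1 inner nodes is
   Node l rt with bsize l = k and bsize rt = m - k, for k = 0..m. *)
Fixpoint all_upto (n : nat) : list (list btree) :=
  match n with
  | O => [[Leaf]]
  | S m =>
      let L := all_upto m in
      L ++ [flat_map (fun k =>
              flat_map (fun l => map (fun rt => Node l rt) (nth (m - k) L []))
                       (nth k L []))
            (seq 0 (S m))]
  end.

Definition trees (n : nat) : list btree := nth n (all_upto n) [].

Definition unif_mean (n : nat) (X : btree -> R) : R :=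
  fold_right Rplus 0 (map X (trees n)) / INR (length (trees n)).

Definition E_nr (n r : nat) : R := unif_mean n (fun t => INR (branches r t)).
Definition V_nr (n r : nat) : R :=
  unif_mean n (fun t => (INR (branches r t) - E_nr n r) ^ 2).

(* Main.v *)
(* An r-branch is determined by its bottom node, which is a leaf (r = 0) or a
   node whose two subtrees both have register function r - 1.  Let N_r be the
   generating function of the trees whose root is such a node, B the Catalan
   series and e = 1 - 4z = (1 - 2zB)^2.  Splitting trees at the root shows that
   the generating functions of the first and second moments are N_r e^(-1/2) and
   N_r e^(-1/2) + 2 z N_r^2 e^(-3/2), and that
   N_(r+1) (e + 4 z N_r) = z N_r^2.  The series N_r converges beyond |z| = 1/4,
   and the recursion yields its Taylor polynomial in e at z = 1/4 up to a
   remainder e^4 H with H again converging beyond 1/4.  Convolving the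
   coefficients of e^(j - 1/2), which are explicit rational multiples of Catalan
   numbers, with such an H does not change their order of magnitude, so
   everything reduces to comparing rational functions of n. *)
Require Import Defs.
From Stdlib Require Import Reals List Arith Lia Lra
  FunctionalExtensionality.
Import ListNotations.
Open Scope R_scope.

(** * Formal power series *)

(** The recursion closes because 1 - 2zL, with L the series of trees of register function below r,
    has square e + 4zN_r. Complex analysis is avoided: analyticity beyond 1/4 is replaced by
    absolute convergence at one real point beyond 1/4. This property is stable under ring operations
    and, by convexity in the evaluation point, under inverting 1 - b when the absolute sum of b at
    1/4 is below 1. It applies to b = 2zL because L(1/4) stays strictly below the Catalan value 2.
    The cut at e^4 serves both moments: e^4 e^(-1/2) has coefficients smaller than the Catalan
    numbers by n^3, and e^4 e^(-3/2) by n^2. In the variance the n^2 terms cancel, and squaring the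
    mean multiplies its error by n, so an error n^(-3) in the mean is just what an error n^(-2) in
    the variance requires. *)

Definition fps := nat -> R.

Declare Scope fps_scope.
Delimit Scope fps_scope with fps.
Bind Scope fps_scope with fps.

Definition ftail (a : fps) : fps := fun n => a (S n).

Definition fconst (c : R) : fps := fun n => match n with O => c | _ => 0 end.
Definition fX : fps := fun n => match n with 1%nat => 1 | _ => 0 end.
Definition fadd (a b : fps) : fps := fun n => a n + b n.
Definition fopp (a : fps) : fps := fun n => - a n.
Definition fsub (a b : fps) : fps := fadd a (fopp b).

(* Cauchy product, by recursion on the degree through
   [a * b = a_0 b + X (tail a * b)]. *)
Fixpoint fmul_coef (n : nat) (a b : fps) : R :=
  match n with
  | O => a O * b O
  | S m => a O * b (S m) + fmul_coef m (ftail a) b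
  end.

Definition fmul (a b : fps) : fps := fun n => fmul_coef n a b.
Arguments fmul : simpl never.

Notation "0" := (fconst 0%R) : fps_scope.
Notation "1" := (fconst 1%R) : fps_scope.
Notation "2" := (fadd (fconst 1) (fconst 1)) : fps_scope.
Notation "4" := (fmul (fadd (fconst 1) (fconst 1)) (fadd (fconst 1) (fconst 1)))
  : fps_scope.
Infix "+" := fadd : fps_scope.
Infix "*" := fmul : fps_scope.
Infix "-" := fsub : fps_scope.
Notation "- a" := (fopp a) : fps_scope.

Lemma fmul_0 a b : fmul a b O = a O * b O.
Proof. reflexivity. Qed.

Lemma fmul_S a b n : fmul a b (S n) = a O * b (S n) + fmul (ftail a) b n.
Proof. reflexivity. Qed.

Lemma fmul_addl a b c n : fmul (fadd a b) c n = fmul a c n + fmul b c n.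
Proof.
  revert a b; induction n as [|n IH]; intros a b; rewrite ?fmul_S, ?fmul_0.
  - unfold fadd; ring.
  - change (ftail (fadd a b)) with (fadd (ftail a) (ftail b)).
    rewrite IH; unfold fadd; ring.
Qed.

Lemma fmul_scall c a b n : fmul (fun k => c * a k) b n = c * fmul a b n.
Proof.
  revert a; induction n as [|n IH]; intros a; rewrite ?fmul_S, ?fmul_0; [ring|].
  change (ftail (fun k => c * a k)) with (fun k => c * ftail a k).
  rewrite IH; ring.
Qed.

Lemma fmul_zerol a n : fmul (fconst 0) a n = 0.
Proof.
  induction n as [|n IH]; rewrite ?fmul_S, ?fmul_0; simpl; [ring|].
  replace (ftail (fconst 0)) with (fconst 0)
    by (apply functional_extensionality; intros []; reflexivity).
  rewrite IH; ring.
Qed.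

Lemma fmul_const c a n : fmul (fconst c) a n = c * a n.
Proof.
  destruct n as [|n]; rewrite ?fmul_S, ?fmul_0; simpl; [reflexivity|].
  replace (ftail (fconst c)) with (fconst 0)
    by (apply functional_extensionality; intros []; reflexivity).
  rewrite fmul_zerol; ring.
Qed.

Lemma fmul_X_0 a : fmul fX a O = 0.
Proof. rewrite ?fmul_S, ?fmul_0; simpl; ring. Qed.

Lemma fmul_X_S a n : fmul fX a (S n) = a n.
Proof.
  rewrite ?fmul_S, ?fmul_0; simpl.
  replace (ftail fX) with (fconst 1)
    by (apply functional_extensionality; intros [|[]]; reflexivity).
  rewrite fmul_const; ring.
Qed.

(** The mirror image of the defining recursion: the top coefficient of the left factor is split off
    instead of the bottom one. Comparing both recursions gives commutativity. *)
Lemma fmul_recr a b n : fmul a b (S n) = a (S n) * b O + fmul a (ftail b) n.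
Proof.
  revert a; induction n as [|n IH]; intros a.
  - rewrite ?fmul_S, ?fmul_0; unfold ftail; ring.
  - change (fmul a b (S (S n)))
      with (a O * b (S (S n)) + fmul (ftail a) b (S n)).
    rewrite IH; rewrite ?fmul_S, ?fmul_0; unfold ftail; ring.
Qed.

Lemma fmul_comm a b : fmul a b = fmul b a.
Proof.
  apply functional_extensionality; intros n; revert a b.
  induction n as [|n IH]; intros a b; [rewrite ?fmul_S, ?fmul_0; ring|].
  rewrite fmul_recr; rewrite ?fmul_S, ?fmul_0; rewrite IH; ring.
Qed.

Lemma fmul_assoc a b c : fmul a (fmul b c) = fmul (fmul a b) c.
Proof.
  apply functional_extensionality; intros n; revert a.
  induction n as [|n IH]; intros a; [rewrite ?fmul_S, ?fmul_0; ring|].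
  change (fmul (fmul a b) c (S n))
    with (a O * b O * c (S n) + fmul (ftail (fmul a b)) c n).
  change (ftail (fmul a b))
    with (fadd (fun k => a O * ftail b k) (fmul (ftail a) b)).
  rewrite fmul_addl, fmul_scall, <- IH; rewrite ?fmul_S, ?fmul_0; ring.
Qed.

(** Registered below so that [ring] proves identities between generating functions; the numerals [2]
    and [4] are built from [fconst 1] so that it can evaluate them. *)
Lemma fps_ring_theory :
  ring_theory (fconst 0) (fconst 1) fadd fmul fsub fopp (@eq fps).
Proof.
  split; intros; try (apply functional_extensionality; intros n);
    try reflexivity.
  - unfold fadd; destruct n; simpl; ring.
  - unfold fadd; ring.
  - unfold fadd; ring.
  - rewrite fmul_const; ring.
  - now rewrite fmul_comm.
  - now rewrite fmul_assoc.
  - unfold fadd at 2; now rewrite fmul_addl.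
  - unfold fadd, fopp; destruct n; simpl; ring.
Qed.

Add Ring fps_ring : fps_ring_theory.

Lemma fconst_add c d : fconst (c + d) = fadd (fconst c) (fconst d).
Proof.
  apply functional_extensionality; intros []; unfold fadd; simpl; ring.
Qed.

Lemma fconst_mul c d : fconst (c * d) = fmul (fconst c) (fconst d).
Proof.
  apply functional_extensionality; intros n; rewrite fmul_const.
  destruct n; simpl; ring.
Qed.

Lemma fconst_sub c d : fconst (c - d) = fsub (fconst c) (fconst d).
Proof.
  apply functional_extensionality; intros []; unfold fsub, fadd, fopp; simpl;
    ring.
Qed.

Lemma fconst_2 : fconst 2 = 2%fps.
Proof. now rewrite <- fconst_add. Qed.

Lemma fconst_4 : fconst 4 = 4%fps.
Proof. rewrite <- fconst_2, <- fconst_mul; f_equal; ring. Qed.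

(** ** Inverses *)

Fixpoint fpow (a : fps) (k : nat) : fps :=
  match k with O => fconst 1 | S j => fmul a (fpow a j) end.

Fixpoint fgeom (b : fps) (m : nat) : fps :=
  match m with O => fconst 1 | S j => fadd (fgeom b j) (fpow b (S j)) end.

(** The geometric series of [b] read on the diagonal: when [b] has no constant term, powers beyond
    the n-th do not reach degree n. *)
Definition finv1m (b : fps) : fps := fun n => fgeom b n n.

Lemma fpow_low b k n : b O = 0 -> (n < k)%nat -> fpow b k n = 0.
Proof.
  intros Hb; revert n; induction k as [|k IH]; intros n Hn; [lia|].
  simpl; rewrite fmul_comm; destruct n as [|n].
  - rewrite fmul_0, Hb; ring.
  - rewrite fmul_recr, Hb.
    assert (H : forall m a, (forall i, (i <= m)%nat -> a i = 0) ->
              fmul a (ftail b) m = 0).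
    { clear; intros m; induction m as [|m IH]; intros a Ha; rewrite ?fmul_S, ?fmul_0.
      - rewrite Ha by lia; ring.
      - rewrite Ha, IH by (lia || (intros; apply Ha; lia)); ring. }
    rewrite H; [ring|]; intros i Hi; apply IH; lia.
Qed.

Lemma fgeom_stable b m n :
  b O = 0 -> (n <= m)%nat -> fgeom b m n = fgeom b n n.
Proof.
  intros Hb H; induction H as [|m H IH]; [reflexivity|].
  simpl; unfold fadd; rewrite IH.
  change (fmul b (fpow b m) n) with (fpow b (S m) n).
  rewrite fpow_low by (trivial || lia); ring.
Qed.

Lemma fmul_ext_le a a' b n :
  (forall i, (i <= n)%nat -> a i = a' i) -> fmul a b n = fmul a' b n.
Proof.
  revert a a'; induction n as [|n IH]; intros a a' H; rewrite ?fmul_S, ?fmul_0.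
  - now rewrite H.
  - rewrite H by lia; f_equal; apply IH; intros; apply H; lia.
Qed.

Lemma fgeom_telescope b m :
  (fgeom b m * (1 - b) = 1 - fpow b (S m))%fps.
Proof.
  induction m as [|m IH]; [simpl; ring|].
  change (fgeom b (S m)) with (fadd (fgeom b m) (fpow b (S m))).
  transitivity (fgeom b m * (1 - b) + fpow b (S m) * (1 - b))%fps; [ring|].
  rewrite IH; simpl; ring.
Qed.

Lemma finv1mP b : b O = 0 -> (finv1m b * (1 - b) = 1)%fps.
Proof.
  intros Hb; apply functional_extensionality; intros n.
  rewrite (fmul_ext_le _ (fgeom b n)).
  - rewrite fgeom_telescope; unfold fsub, fadd, fopp.
    rewrite fpow_low by (trivial || lia); ring.
  - intros i Hi; unfold finv1m; symmetry; now apply fgeom_stable.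
Qed.

(** ** The Euler derivation [z d/dz] *)

Definition feuler (a : fps) : fps := fun n => INR n * a n.

Lemma feuler_mul a b :
  feuler (a * b) = (feuler a * b + a * feuler b)%fps.
Proof.
  apply functional_extensionality; intros n; unfold fadd, feuler at 1.
  revert a; induction n as [|n IH]; intros a.
  - rewrite !fmul_0; unfold feuler; simpl; ring.
  - change (fmul (feuler a) b (S n))
      with (feuler a O * b (S n) + fmul (ftail (feuler a)) b n).
    replace (ftail (feuler a)) with (fadd (feuler (ftail a)) (ftail a)).
    2:{ apply functional_extensionality; intros k.
        unfold fadd, ftail, feuler; rewrite S_INR; ring. }
    rewrite fmul_addl, !fmul_S.
    specialize (IH (ftail a)).
    replace (feuler a O) with 0 by (unfold feuler; simpl; ring).
    replace (feuler b (S n)) with ((INR n + 1) * b (S n))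
      by (unfold feuler; rewrite S_INR; ring).
    rewrite S_INR; lra.
Qed.

(** * Sums over all trees of a given size *)

Definition lsum (l : list R) : R := fold_right Rplus 0 l.

Lemma lsum_app l l' : lsum (l ++ l') = lsum l + lsum l'.
Proof. induction l as [|x l IH]; simpl; [|rewrite IH]; ring. Qed.

Lemma lsum_map_flat_map {A B : Type} (f : B -> R) (g : A -> list B) l :
  lsum (map f (flat_map g l)) = lsum (map (fun a => lsum (map f (g a))) l).
Proof.
  induction l as [|a l IH]; simpl; [reflexivity|].
  now rewrite map_app, lsum_app, IH.
Qed.

Lemma lsum_map_add {A : Type} (f g : A -> R) l :
  lsum (map (fun a => f a + g a) l) = lsum (map f l) + lsum (map g l).
Proof. induction l as [|a l IH]; simpl; [|rewrite IH]; ring. Qed.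

Lemma lsum_map_scal {A : Type} c (f : A -> R) l :
  lsum (map (fun a => c * f a) l) = c * lsum (map f l).
Proof. induction l as [|a l IH]; simpl; [|rewrite IH]; ring. Qed.

Lemma lsum_map_le {A : Type} (f g : A -> R) l :
  (forall a, f a <= g a) -> lsum (map f l) <= lsum (map g l).
Proof.
  intros H; induction l as [|a l IH]; simpl; [lra|].
  specialize (H a); lra.
Qed.

Lemma fmul_lsum a b n :
  fmul a b n = lsum (map (fun k => a k * b (n - k)%nat) (seq 0 (S n))).
Proof.
  revert a; induction n as [|n IH]; intros a.
  - rewrite fmul_0; simpl; ring.
  - rewrite fmul_S, IH.
    change (seq 0 (S (S n))) with (0%nat :: seq 1 (S n)).
    rewrite <- seq_shift; simpl map; rewrite map_map; reflexivity.
Qed.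

Lemma length_all_upto n : length (all_upto n) = S n.
Proof.
  induction n as [|n IH]; [reflexivity|].
  simpl; rewrite length_app, IH; simpl; lia.
Qed.

Lemma nth_all_upto n k : (k <= n)%nat -> nth k (all_upto n) [] = trees k.
Proof.
  intros H; induction H as [|n H IH]; [reflexivity|].
  simpl; rewrite app_nth1; [assumption|rewrite length_all_upto; lia].
Qed.

Lemma trees_S m :
  trees (S m) =
  flat_map (fun k => flat_map (fun l => map (Node l) (trees (m - k))) (trees k))
    (seq 0 (S m)).
Proof.
  unfold trees at 1; cbn [all_upto].
  rewrite app_nth2 by (rewrite length_all_upto; lia).
  rewrite length_all_upto, Nat.sub_diag; cbn [nth].
  rewrite !flat_map_concat_map; f_equal; apply map_ext_in; intros k Hk.
  apply in_seq in Hk; rewrite !nth_all_upto by lia; reflexivity.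
Qed.

Definition tsum (h : btree -> R) : fps := fun n => lsum (map h (trees n)).

Definition tsum2 (g : btree -> btree -> R) : fps := fun n =>
  lsum (map (fun k => lsum (map (fun l => lsum (map (g l) (trees (n - k))))
                              (trees k))) (seq 0 (S n))).

Lemma tsum_node h :
  tsum h = (fconst (h Leaf) + fX * tsum2 (fun a b => h (Node a b)))%fps.
Proof.
  apply functional_extensionality; intros [|m]; unfold fadd.
  - rewrite fmul_X_0; unfold tsum; simpl; ring.
  - rewrite fmul_X_S; unfold tsum, tsum2; rewrite trees_S, lsum_map_flat_map.
    simpl fconst; rewrite Rplus_0_l; f_equal; apply map_ext; intros k.
    rewrite lsum_map_flat_map; f_equal; apply map_ext; intros l.
    now rewrite map_map.
Qed.

Lemma tsum2_mul f g : tsum2 (fun a b => f a * g b) = (tsum f * tsum g)%fps.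
Proof.
  apply functional_extensionality; intros n; rewrite fmul_lsum.
  unfold tsum2, tsum; f_equal; apply map_ext; intros k.
  rewrite Rmult_comm, <- lsum_map_scal; f_equal; apply map_ext; intros l.
  rewrite lsum_map_scal; ring.
Qed.

Lemma tsum2_add f g :
  tsum2 (fun a b => f a b + g a b) = (tsum2 f + tsum2 g)%fps.
Proof.
  apply functional_extensionality; intros n; unfold tsum2, fadd.
  rewrite <- lsum_map_add; f_equal; apply map_ext; intros k.
  rewrite <- lsum_map_add; f_equal; apply map_ext; intros l.
  now rewrite <- lsum_map_add.
Qed.

Lemma tsum2_ext f g : (forall a b, f a b = g a b) -> tsum2 f = tsum2 g.
Proof.
  intros H; f_equal; do 2 (apply functional_extensionality; intro); apply H.
Qed.

Lemma tsum_add f g : tsum (fun t => f t + g t) = (tsum f + tsum g)%fps.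
Proof.
  apply functional_extensionality; intros n; apply lsum_map_add.
Qed.

Lemma tsum_ext f g : (forall t, f t = g t) -> tsum f = tsum g.
Proof. intros H; f_equal; now apply functional_extensionality. Qed.

(** * Generating functions of the register function and of branches *)

Definition indic (b : bool) : R := if b then 1 else 0.

Definition gf_all : fps := tsum (fun _ => 1).
Definition gf_reg (r : nat) : fps := tsum (fun t => indic (Reg t =? r)%nat).
Definition gf_reg_lt (r : nat) : fps := tsum (fun t => indic (Reg t <? r)%nat).
Definition gf_branches (r : nat) : fps := tsum (fun t => INR (branches r t)).
Definition gf_branches_sqr (r : nat) : fps :=
  tsum (fun t => INR (branches r t) ^ 2).

(* Trees whose root is the bottom node of an r-branch: a single leaf if
   [r = 0], two subtrees of register function [r - 1] otherwise. *)
Definition gf_bottom (r : nat) : fps :=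
  match r with
  | O => fconst 1
  | S p => fmul fX (fmul (gf_reg p) (gf_reg p))
  end.

Lemma gf_all_eq : (gf_all = 1 + fX * (gf_all * gf_all))%fps.
Proof.
  unfold gf_all at 1; rewrite tsum_node; f_equal; f_equal.
  unfold gf_all; rewrite <- tsum2_mul; apply tsum2_ext; intros; ring.
Qed.

Ltac nat_cases :=
  repeat match goal with
    | |- context [(?a =? ?b)%nat] => destruct (Nat.eqb_spec a b)
    | |- context [(?a <? ?b)%nat] => destruct (Nat.ltb_spec a b)
    end.

Lemma Reg_Node a b :
  Reg (Node a b) =
  if (Reg a =? Reg b)%nat then S (Reg a) else Nat.max (Reg a) (Reg b).
Proof. reflexivity. Qed.

Lemma gf_reg_lt_0 : gf_reg_lt 0 = 0%fps.
Proof.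
  apply functional_extensionality; intros n; unfold gf_reg_lt, tsum.
  rewrite (map_ext _ (fun _ : btree => 0 * 0)) by (intros; simpl; ring).
  rewrite lsum_map_scal; destruct n; simpl; ring.
Qed.

Lemma gf_reg_lt_S r : (gf_reg_lt (S r) = gf_reg_lt r + gf_reg r)%fps.
Proof.
  unfold gf_reg_lt, gf_reg; rewrite <- tsum_add; apply tsum_ext; intros t.
  nat_cases; simpl; try ring; lia.
Qed.

Lemma gf_reg_0 : gf_reg 0 = 1%fps.
Proof.
  unfold gf_reg; rewrite tsum_node.
  change (indic (Reg Leaf =? 0)%nat) with 1.
  rewrite (tsum2_ext _ (fun _ _ => 0 * 0)).
  - rewrite (tsum2_mul (fun _ => 0) (fun _ => 0)).
    replace (tsum (fun _ => 0)) with 0%fps; [ring|].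
    rewrite <- gf_reg_lt_0; reflexivity.
  - intros a b; rewrite Reg_Node.
    destruct (Nat.eqb_spec (Reg a) (Reg b)); nat_cases; simpl; try ring; lia.
Qed.

(** A root has label [S r] either because both children have label [r], or because one child has
    label [S r] and the other, on either side, a smaller one. *)
Lemma gf_reg_S r :
  (gf_reg (S r) = fX * (gf_reg r * gf_reg r)
                  + 2 * fX * (gf_reg_lt (S r) * gf_reg (S r)))%fps.
Proof.
  unfold gf_reg at 1; rewrite tsum_node; simpl (indic _).
  transitivity (fX * (gf_reg r * gf_reg r
      + (gf_reg_lt (S r) * gf_reg (S r) + gf_reg (S r) * gf_reg_lt (S r))))%fps;
    [|ring].
  unfold gf_reg, gf_reg_lt; rewrite <- !tsum2_mul, <- !tsum2_add.
  transitivity (0 + fX * tsum2 (fun a b => indic (Reg (Node a b) =? S r)%nat))%fps;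
    [reflexivity|].
  match goal with |- (0 + fX * ?u = fX * ?v)%fps => replace u with v end;
    [ring|].
  apply tsum2_ext; intros a b; rewrite Reg_Node.
  destruct (Nat.eqb_spec (Reg a) (Reg b)); nat_cases; simpl; try ring; lia.
Qed.

(** Walking up an r-branch from its bottom node, every further node adds a sibling subtree of
    smaller register function on one of two sides, that is, a factor [2 * fX * gf_reg_lt r]. *)
Lemma gf_reg_bottom r :
  (gf_reg r * (1 - 2 * fX * gf_reg_lt r) = gf_bottom r)%fps.
Proof.
  destruct r as [|r]; simpl.
  - rewrite gf_reg_lt_0, gf_reg_0; ring.
  - transitivity
      (gf_reg (S r) - 2 * fX * (gf_reg_lt (S r) * gf_reg (S r)))%fps; [ring|].
    rewrite gf_reg_S at 1; ring.
Qed.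

Lemma branches_aux_true r t :
  branches r t = (branches_aux r true t + if (Reg t =? r) then 1 else 0)%nat.
Proof.
  unfold branches; destruct t; cbn [branches_aux];
    match goal with |- context [(?u =? r)%nat] => destruct (u =? r)%nat end; lia.
Qed.

(** The definition counts a branch at its top node; here the count moves to the bottom node. If a
    child passes its label [r] to the root, the start at the root replaces the one lost at the
    child. Writing [S (Reg a) =? r] avoids truncated subtraction at [r = 0]. *)
Lemma branches_Node r a b :
  branches r (Node a b) =
  (branches r a + branches r b
   + if andb (S (Reg a) =? r) (S (Reg b) =? r) then 1 else 0)%nat.
Proof.
  pose proof (branches_aux_true r a) as Ha.
  pose proof (branches_aux_true r b) as Hb.
  unfold branches at 1; cbn [branches_aux].
  rewrite Reg_Node.
  change (branches_aux r false) with (branches r).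
  destruct (Nat.eqb_spec (Reg a) (Reg b)) as [E|E].
  - rewrite E in *; destruct (Nat.eqb_spec (S (Reg b)) r) as [E'|E']; simpl.
    + destruct (Nat.eqb_spec (Reg b) r); lia.
    + unfold branches; lia.
  - destruct (Nat.eqb_spec (Nat.max (Reg a) (Reg b)) r) as [E'|E'];
      destruct (Nat.eqb_spec (S (Reg a)) r); destruct (Nat.eqb_spec (S (Reg b)) r);
      destruct (Nat.eqb_spec (Reg a) r); destruct (Nat.eqb_spec (Reg b) r);
      cbn [andb] in *; unfold branches in *; lia.
Qed.

Lemma branches_Leaf r : branches r Leaf = if (r =? 0)%nat then 1%nat else 0%nat.
Proof. now destruct r. Qed.

Lemma branches_Reg_lt r t : (Reg t < r)%nat -> branches r t = 0%nat.
Proof.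
  induction t as [|a IHa b IHb]; intros H.
  - now destruct r; [simpl in H; lia|].
  - rewrite Reg_Node in H; rewrite branches_Node.
    destruct (Nat.eqb_spec (Reg a) (Reg b));
      rewrite IHa, IHb by lia;
      destruct (Nat.eqb_spec (S (Reg a)) r); destruct (Nat.eqb_spec (S (Reg b)) r);
      simpl; lia.
Qed.

Definition is_bottom (r : nat) (a b : btree) : R :=
  indic (andb (S (Reg a) =? r) (S (Reg b) =? r))%nat.

Lemma INR_branches_Node r a b :
  INR (branches r (Node a b))
  = INR (branches r a) * 1 + 1 * INR (branches r b) + is_bottom r a b.
Proof.
  unfold is_bottom, indic; rewrite branches_Node, !plus_INR.
  destruct (andb _ _); simpl; ring.
Qed.

(* A bottom node of an r-branch has no further r-branch below it, so the
   cross terms with the indicator vanish. *)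
Lemma INR_branches_sqr_Node r a b :
  INR (branches r (Node a b)) ^ 2
  = INR (branches r a) ^ 2 * 1 + 1 * INR (branches r b) ^ 2
    + (INR (branches r a) * INR (branches r b)
       + INR (branches r a) * INR (branches r b)) + is_bottom r a b.
Proof.
  rewrite INR_branches_Node; unfold is_bottom, indic.
  destruct (Nat.eqb_spec (S (Reg a)) r); destruct (Nat.eqb_spec (S (Reg b)) r);
    simpl andb; cbv iota; try ring.
  rewrite !branches_Reg_lt by lia; simpl; ring.
Qed.

Lemma gf_bottom_eq r :
  (gf_bottom r = fconst (INR (branches r Leaf)) + fX * tsum2 (is_bottom r))%fps.
Proof.
  rewrite branches_Leaf; destruct r as [|r]; simpl.
  - rewrite (tsum2_ext _ (fun _ _ => 0 * 0)) by
      (intros; unfold is_bottom, indic; simpl; ring).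
    rewrite (tsum2_mul (fun _ => 0) (fun _ => 0)).
    replace (tsum (fun _ => 0)) with 0%fps; [ring|].
    rewrite <- gf_reg_lt_0; reflexivity.
  - unfold gf_reg; rewrite <- tsum2_mul.
    match goal with |- (fX * ?u = 0 + fX * ?v)%fps => replace u with v end;
      [ring|].
    apply tsum2_ext; intros a b; unfold is_bottom; simpl.
    nat_cases; simpl; ring.
Qed.

Lemma gf_branches_eq r :
  (gf_branches r * (1 - 2 * fX * gf_all) = gf_bottom r)%fps.
Proof.
  assert (H : (gf_branches r
    = gf_bottom r + 2 * fX * gf_all * gf_branches r)%fps).
  { rewrite gf_bottom_eq; unfold gf_branches at 1; rewrite tsum_node.
    rewrite (tsum2_ext _ _ (INR_branches_Node r)), !tsum2_add.
    rewrite (tsum2_mul (fun a => INR (branches r a)) (fun _ => 1)).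
    rewrite (tsum2_mul (fun _ => 1) (fun a => INR (branches r a))).
    fold (gf_branches r) gf_all; ring. }
  transitivity (gf_branches r - 2 * fX * gf_all * gf_branches r)%fps; [ring|].
  rewrite H at 1; ring.
Qed.

Lemma gf_branches_sqr_eq r :
  (gf_branches_sqr r * (1 - 2 * fX * gf_all)
   = gf_bottom r + 2 * fX * (gf_branches r * gf_branches r))%fps.
Proof.
  assert (H : (gf_branches_sqr r
    = gf_bottom r + 2 * fX * (gf_branches r * gf_branches r)
      + 2 * fX * gf_all * gf_branches_sqr r)%fps).
  { rewrite gf_bottom_eq; unfold gf_branches_sqr at 1; rewrite tsum_node.
    rewrite (tsum2_ext _ _ (INR_branches_sqr_Node r)), !tsum2_add.
    rewrite (tsum2_mul (fun a => INR (branches r a) ^ 2) (fun _ => 1)).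
    rewrite (tsum2_mul (fun _ => 1) (fun a => INR (branches r a) ^ 2)).
    rewrite (tsum2_mul (fun a => INR (branches r a)) (fun a => INR (branches r a))).
    fold (gf_branches r) (gf_branches_sqr r) gf_all.
    replace (INR (branches r Leaf) ^ 2) with (INR (branches r Leaf))
      by (rewrite branches_Leaf; destruct (r =? 0)%nat; simpl; ring).
    ring. }
  transitivity (gf_branches_sqr r - 2 * fX * gf_all * gf_branches_sqr r)%fps;
    [ring|].
  rewrite H at 1; ring.
Qed.

Definition feps : fps := (1 - 4 * fX)%fps.

(** A telescoping: going from [r] to [S r] subtracts [2 * fX * gf_reg r] from the factor. In the new
    square the cross term cancels [4 * fX * gf_bottom r] by [gf_reg_bottom], and the last square is
    [4 * fX * gf_bottom (S r)]. *)
Lemma gf_reg_lt_quadratic r :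
  ((1 - 2 * fX * gf_reg_lt r) * (1 - 2 * fX * gf_reg_lt r)
   = feps + 4 * fX * gf_bottom r)%fps.
Proof.
  unfold feps; induction r as [|r IH].
  - rewrite gf_reg_lt_0; simpl; ring.
  - rewrite gf_reg_lt_S.
    transitivity ((1 - 2 * fX * gf_reg_lt r) * (1 - 2 * fX * gf_reg_lt r)
      - 4 * fX * (gf_reg r * (1 - 2 * fX * gf_reg_lt r))
      + 4 * fX * (fX * (gf_reg r * gf_reg r)))%fps; [ring|].
    rewrite IH, gf_reg_bottom; simpl; ring.
Qed.

Lemma gf_bottom_S r :
  (gf_bottom (S r) * ((1 - 2 * fX * gf_reg_lt r) * (1 - 2 * fX * gf_reg_lt r))
   = fX * (gf_bottom r * gf_bottom r))%fps.
Proof. simpl; rewrite <- gf_reg_bottom; ring. Qed.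

(** * Series converging absolutely beyond the radius 1/4 *)

(** Peels off the first term through [ftail], like [fmul_coef], so that inductions on products and
    on sums proceed in step; index [N] is included. *)
Fixpoint psum (a : fps) (N : nat) : R :=
  match N with O => a O | S m => a O + psum (ftail a) m end.

Lemma psum_recr a N : psum a (S N) = psum a N + a (S N).
Proof.
  revert a; induction N as [|N IH]; intros a; [reflexivity|].
  change (psum a (S (S N))) with (a O + psum (ftail a) (S N)).
  rewrite IH; simpl; unfold ftail; ring.
Qed.

Lemma psum_le a b N : (forall n, a n <= b n) -> psum a N <= psum b N.
Proof.
  revert a b; induction N as [|N IH]; intros a b H; simpl; [apply H|].
  apply Rplus_le_compat; [apply H|]; apply IH; intros; apply H.
Qed.

Lemma psum_ge0 a N : (forall n, 0 <= a n) -> 0 <= psum a N.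
Proof.
  revert a; induction N as [|N IH]; intros a H; simpl; [apply H|].
  apply Rplus_le_le_0_compat; [apply H|]; apply IH; intros; apply H.
Qed.

Lemma psum_add a b N : psum (fadd a b) N = psum a N + psum b N.
Proof.
  revert a b; induction N as [|N IH]; intros a b; [reflexivity|].
  simpl; change (ftail (fadd a b)) with (fadd (ftail a) (ftail b)).
  rewrite IH; unfold fadd; ring.
Qed.

Lemma psum_scal c a N : psum (fun n => c * a n) N = c * psum a N.
Proof.
  revert a; induction N as [|N IH]; intros a; [reflexivity|].
  simpl; change (ftail (fun n => c * a n)) with (fun n => c * ftail a n).
  rewrite IH; ring.
Qed.

Lemma psum_mono a M N :
  (forall n, 0 <= a n) -> (M <= N)%nat -> psum a M <= psum a N.
Proof.
  intros Ha H; induction H as [|N H IH]; [lra|].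
  rewrite psum_recr; specialize (Ha (S N)); lra.
Qed.

Lemma psum_ge_term a n N :
  (forall n, 0 <= a n) -> (n <= N)%nat -> a n <= psum a N.
Proof.
  intros Ha H; apply Rle_trans with (psum a n); [|now apply psum_mono].
  destruct n as [|n]; [simpl; lra|].
  rewrite psum_recr; pose proof (psum_ge0 a n Ha); lra.
Qed.

Lemma fmul_ge0 a b n :
  (forall n, 0 <= a n) -> (forall n, 0 <= b n) -> 0 <= fmul a b n.
Proof.
  intros Ha Hb; revert a Ha; induction n as [|n IH]; intros a Ha.
  - rewrite fmul_0; now apply Rmult_le_pos.
  - rewrite fmul_S; apply Rplus_le_le_0_compat; [now apply Rmult_le_pos|].
    apply IH; intros; apply Ha.
Qed.

Lemma fmul_ge_term a b i j :
  (forall n, 0 <= a n) -> (forall n, 0 <= b n) -> a i * b j <= fmul a b (i + j)%nat.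
Proof.
  intros Ha Hb; revert a Ha; induction i as [|i IH]; intros a Ha; simpl.
  - destruct j as [|j]; [rewrite fmul_0; lra|].
    rewrite fmul_S.
    assert (0 <= fmul (ftail a) b j) by (apply fmul_ge0; intros; auto; apply Ha).
    lra.
  - rewrite fmul_S.
    assert (a (S i) * b j <= fmul (ftail a) b (i + j)%nat)
      by (apply (IH (ftail a)); intros; apply Ha).
    pose proof (Rmult_le_pos _ _ (Ha O) (Hb (S (i + j)%nat))); lra.
Qed.

(** The right side runs over a square of index pairs, the left side only over the triangle i + j <=
    N. Truncating both sides at the same [N] is what later makes self-referential bounds usable. *)
Lemma psum_mul_le a b N :
  (forall n, 0 <= a n) -> (forall n, 0 <= b n) ->
  psum (fmul a b) N <= psum a N * psum b N.
Proof.
  intros Ha Hb; revert a Ha; induction N as [|N IH]; intros a Ha.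
  - simpl; rewrite fmul_0; lra.
  - assert (E : psum (fmul a b) (S N)
                = a O * psum b (S N) + psum (fmul (ftail a) b) N).
    { simpl; rewrite fmul_0.
      change (ftail (fmul a b))
        with (fadd (fun k => a O * ftail b k) (fmul (ftail a) b)).
      rewrite psum_add, psum_scal; ring. }
    assert (Ha' : forall n, 0 <= ftail a n) by (intros; apply Ha).
    pose proof (IH _ Ha').
    pose proof (psum_mono b N (S N) Hb ltac:(lia)).
    pose proof (psum_ge0 _ N Ha').
    assert (psum (ftail a) N * psum b N <= psum (ftail a) N * psum b (S N))
      by now apply Rmult_le_compat_l.
    rewrite E; change (psum a (S N)) with (a O + psum (ftail a) N); lra.
Qed.

Definition fmaj (x : R) (a : fps) : fps := fun n => Rabs (a n) * x ^ n.

Lemma fmaj_ge0 x a n : 0 <= x -> 0 <= fmaj x a n.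
Proof. intros; apply Rmult_le_pos; [apply Rabs_pos|now apply pow_le]. Qed.

Lemma ftail_fmaj x a : ftail (fmaj x a) = (fun n => x * fmaj x (ftail a) n).
Proof.
  apply functional_extensionality; intros n; unfold ftail, fmaj; simpl; ring.
Qed.

Lemma fmaj_mul_le x a b n :
  0 <= x -> fmaj x (fmul a b) n <= fmul (fmaj x a) (fmaj x b) n.
Proof.
  intros Hx; revert a; induction n as [|n IH]; intros a.
  - rewrite fmul_0; unfold fmaj; rewrite fmul_0, Rabs_mult; simpl; lra.
  - rewrite fmul_S, ftail_fmaj, fmul_scall.
    apply Rle_trans with
      (fmaj x a O * fmaj x b (S n) + x * fmaj x (fmul (ftail a) b) n).
    2:{ apply Rplus_le_compat_l, Rmult_le_compat_l; auto. }
    unfold fmaj; rewrite fmul_S; simpl pow.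
    pose proof (Rabs_triang (a O * b (S n)) (fmul (ftail a) b n)) as H.
    rewrite Rabs_mult in H.
    assert (0 <= x * x ^ n) by (apply Rmult_le_pos; [|apply pow_le]; auto).
    apply Rle_trans with
      ((Rabs (a O) * Rabs (b (S n)) + Rabs (fmul (ftail a) b n)) * (x * x ^ n));
      [now apply Rmult_le_compat_r|lra].
Qed.

Lemma psum_fmaj_mul_le x a b N :
  0 <= x -> psum (fmaj x (fmul a b)) N <= psum (fmaj x a) N * psum (fmaj x b) N.
Proof.
  intros Hx; eapply Rle_trans;
    [apply psum_le; intros; now apply fmaj_mul_le|].
  apply psum_mul_le; intros; now apply fmaj_ge0.
Qed.

Lemma psum_fmaj_add_le x a b N :
  0 <= x -> psum (fmaj x (fadd a b)) N <= psum (fmaj x a) N + psum (fmaj x b) N.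
Proof.
  intros Hx; rewrite <- psum_add; apply psum_le; intros n; unfold fadd, fmaj.
  rewrite <- Rmult_plus_distr_r; apply Rmult_le_compat_r;
    [now apply pow_le|apply Rabs_triang].
Qed.

Lemma psum_fmaj_const x c N : psum (fmaj x (fconst c)) N = Rabs c.
Proof.
  induction N as [|N IH]; [unfold fmaj; simpl; ring|].
  rewrite psum_recr, IH; unfold fmaj; simpl; rewrite Rabs_R0; ring.
Qed.

Lemma psum_fmaj_X x a N :
  psum (fmaj x (fmul fX a)) (S N) = x * psum (fmaj x a) N.
Proof.
  simpl; rewrite ftail_fmaj, psum_scal.
  replace (ftail (fmul fX a)) with a
    by (apply functional_extensionality; intros; symmetry; apply fmul_X_S).
  unfold fmaj at 1; rewrite fmul_X_0, Rabs_R0; ring.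
Qed.

Definition summable (x : R) (a : fps) : Prop :=
  exists K, forall N, psum (fmaj x a) N <= K.

Definition small (a : fps) : Prop := exists x, / 4 < x /\ summable x a.

Lemma summable_mono x y a : 0 <= y <= x -> summable x a -> summable y a.
Proof.
  intros [Hy Hxy] [K HK]; exists K; intros N; eapply Rle_trans; [|apply HK].
  apply psum_le; intros n; apply Rmult_le_compat_l; [apply Rabs_pos|].
  now apply pow_incr.
Qed.

Lemma small_common a b :
  small a -> small b -> exists x, / 4 < x /\ summable x a /\ summable x b.
Proof.
  intros [x [Hx Ha]] [y [Hy Hb]]; exists (Rmin x y).
  assert (/ 4 < Rmin x y) by now apply Rmin_glb_lt.
  split; [assumption|split]; eapply summable_mono; try eassumption; split;
    try lra; [apply Rmin_l|apply Rmin_r].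
Qed.

Lemma small_add a b : small a -> small b -> small (fadd a b).
Proof.
  intros Ha Hb; destruct (small_common a b Ha Hb) as [x [Hx [[K HK] [L HL]]]].
  exists x; split; [assumption|exists (K + L); intros N].
  eapply Rle_trans; [apply psum_fmaj_add_le; lra|].
  specialize (HK N); specialize (HL N); lra.
Qed.

Lemma small_mul a b : small a -> small b -> small (fmul a b).
Proof.
  intros Ha Hb; destruct (small_common a b Ha Hb) as [x [Hx [[K HK] [L HL]]]].
  exists x; split; [assumption|exists (K * L); intros N].
  eapply Rle_trans; [apply psum_fmaj_mul_le; lra|].
  apply Rmult_le_compat; auto; apply psum_ge0; intros; apply fmaj_ge0; lra.
Qed.

Lemma small_const c : small (fconst c).
Proof.
  exists 1; split; [lra|exists (Rabs c); intros N].
  rewrite psum_fmaj_const; lra.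
Qed.

Lemma small_opp a : small a -> small (fopp a).
Proof.
  intros H; replace (fopp a) with (fconst (-1) * a)%fps.
  - apply small_mul; [apply small_const|assumption].
  - apply functional_extensionality; intros n; rewrite fmul_const.
    unfold fopp; ring.
Qed.

Lemma small_sub a b : small a -> small b -> small (fsub a b).
Proof. intros; apply small_add; [|apply small_opp]; assumption. Qed.

Lemma small_X : small fX.
Proof.
  exists 1; split; [lra|exists 1; intros N].
  replace fX with (fX * 1)%fps by ring.
  destruct N as [|N].
  - simpl; unfold fmaj; rewrite fmul_X_0, Rabs_R0; lra.
  - rewrite psum_fmaj_X, psum_fmaj_const, Rabs_R1; lra.
Qed.

Lemma small_eps : small feps.
Proof.
  unfold feps; repeat (apply small_sub || apply small_mul || apply small_add
                       || apply small_const || apply small_X).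
Qed.

Lemma pow_convex u v t n :
  0 <= u <= v -> 0 <= t <= 1 ->
  ((1 - t) * u + t * v) ^ n <= (1 - t) * u ^ n + t * v ^ n.
Proof.
  intros Huv Ht; induction n as [|n IH]; simpl; [lra|].
  assert (u ^ n <= v ^ n) by now apply pow_incr.
  assert (0 <= (1 - t) * u + t * v)
    by (apply Rplus_le_le_0_compat; apply Rmult_le_pos; lra).
  eapply Rle_trans; [apply Rmult_le_compat_l; eassumption|].
  (* Exactly the gap between the product of the two convex combinations and the right-hand side at
     exponent [S n]. *)
  assert (0 <= ((1 - t) * t) * ((v - u) * (v ^ n - u ^ n)))
    by (apply Rmult_le_pos; apply Rmult_le_pos; lra).
  nra.
Qed.

(** A quantitative substitute for continuity: the weighted sum is convex in the weight, so a bound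
    [K] at some [v] beyond [/ 4] limits how fast it grows from [beta]. *)
Lemma small_lt1_beyond b beta :
  small b -> beta < 1 -> (forall N, psum (fmaj (/ 4) b) N <= beta) ->
  exists x beta', / 4 < x /\ beta' < 1 /\ forall N, psum (fmaj x b) N <= beta'.
Proof.
  intros [v [Hv [K HK]]] Hbeta Hb.
  assert (H0 : 0 <= beta)
    by (eapply Rle_trans; [apply (psum_ge0 (fmaj (/ 4) b) O)|apply Hb];
        intros; apply fmaj_ge0; lra).
  assert (HK0 : 0 <= K)
    by (eapply Rle_trans; [apply (psum_ge0 (fmaj v b) O)|apply HK];
        intros; apply fmaj_ge0; lra).
  (* Makes [t * (K + 1)] half of [1 - beta], so that [beta + t * K] is at most [(1 + beta) / 2]; the
     [+ 1] keeps the denominator positive when [K] is 0. *)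
  set (t := (1 - beta) / (2 * (K + 1))).
  assert (Et : t * (2 * (K + 1)) = 1 - beta) by (unfold t; field; lra).
  assert (Ht0 : 0 < t) by (apply Rdiv_lt_0_compat; lra).
  assert (Ht1 : t <= 1) by nra.
  exists ((1 - t) * / 4 + t * v), ((1 + beta) / 2).
  split; [nra|split; [lra|intros N]].
  apply Rle_trans with ((1 - t) * psum (fmaj (/ 4) b) N + t * psum (fmaj v b) N).
  - rewrite <- !psum_scal, <- psum_add; apply psum_le; intros n; unfold fadd, fmaj.
    pose proof (pow_convex (/ 4) v t n ltac:(lra) ltac:(lra)) as H.
    apply (Rmult_le_compat_l (Rabs (b n)) _ _ (Rabs_pos _)) in H; lra.
  - specialize (Hb N); specialize (HK N).
    assert ((1 - t) * psum (fmaj (/ 4) b) N <= (1 - t) * beta)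
      by (apply Rmult_le_compat_l; lra).
    assert (t * psum (fmaj v b) N <= t * K) by (apply Rmult_le_compat_l; lra).
    nra.
Qed.

(** The inverse satisfies [Y = 1 + b * Y], so each truncated weighted sum [s] of it obeys
    [s <= 1 + g * s] with [g < 1], whence [s <= / (1 - g)] uniformly in the truncation. *)
Lemma small_finv1m b beta :
  small b -> b O = 0 -> beta < 1 -> (forall N, psum (fmaj (/ 4) b) N <= beta) ->
  small (finv1m b).
Proof.
  intros Hs H0 Hbeta Hb.
  destruct (small_lt1_beyond b beta Hs Hbeta Hb) as [x [g [Hx [Hg H]]]].
  exists x; split; [assumption|exists (/ (1 - g)); intros N].
  assert (E : finv1m b = (1 + b * finv1m b)%fps).
  { pose proof (finv1mP b H0) as E.
    transitivity (finv1m b * (1 - b) + b * finv1m b)%fps; [ring|].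
    now rewrite E. }
  pose proof (psum_fmaj_add_le x 1%fps (b * finv1m b)%fps N ltac:(lra)) as H1.
  rewrite <- E, psum_fmaj_const, Rabs_R1 in H1.
  pose proof (psum_fmaj_mul_le x b (finv1m b) N ltac:(lra)) as H2.
  specialize (H N).
  assert (0 <= psum (fmaj x (finv1m b)) N)
    by (apply psum_ge0; intros; apply fmaj_ge0; lra).
  apply Rmult_le_reg_r with (1 - g); [lra|].
  rewrite Rinv_l by lra; nra.
Qed.

(** * Convergence of the register series beyond 1/4 *)

Lemma tsum_ge0 h n : (forall t, 0 <= h t) -> 0 <= tsum h n.
Proof.
  intros H; replace 0 with (0 * lsum (map (fun _ : btree => 0) (trees n))) by ring.
  rewrite <- lsum_map_scal; apply lsum_map_le; intros t; rewrite Rmult_0_l; auto.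
Qed.

Lemma indic_ge0 b : 0 <= indic b.
Proof. destruct b; simpl; lra. Qed.

Lemma gf_reg_ge0 r n : 0 <= gf_reg r n.
Proof. apply tsum_ge0; intros; apply indic_ge0. Qed.

Lemma gf_reg_lt_ge0 r n : 0 <= gf_reg_lt r n.
Proof. apply tsum_ge0; intros; apply indic_ge0. Qed.

Lemma gf_reg_pos r : exists n, 0 < gf_reg r n.
Proof.
  induction r as [|r [n Hn]].
  - exists O; rewrite gf_reg_0; simpl; lra.
  (* Witness: two subtrees of size [n] and label [r] under a common root. *)
  - exists (S (n + n)%nat); rewrite gf_reg_S; unfold fadd at 1.
    rewrite fmul_X_S.
    pose proof (fmul_ge_term (gf_reg r) (gf_reg r) n n (gf_reg_ge0 r)
                  (gf_reg_ge0 r)).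
    assert (0 < gf_reg r n * gf_reg r n) by now apply Rmult_lt_0_compat.
    replace (2 * fX * (gf_reg_lt (S r) * gf_reg (S r)))%fps with
      (fX * (gf_reg_lt (S r) * gf_reg (S r))
       + fX * (gf_reg_lt (S r) * gf_reg (S r)))%fps by ring.
    unfold fadd; rewrite fmul_X_S.
    pose proof (fmul_ge0 (gf_reg_lt (S r)) (gf_reg (S r)) (n + n)%nat
                  (gf_reg_lt_ge0 _) (gf_reg_ge0 _)).
    lra.
Qed.

(* The value of the Catalan generating function at its singularity 1/4 is 2. *)
Lemma psum_gf_all_le N : psum (fmaj (/ 4) gf_all) N <= 2.
Proof.
  induction N as [|N IH].
  - unfold gf_all, tsum, fmaj; simpl; rewrite Rplus_0_r, Rabs_R1; lra.
  (* The bound 2 reproduces itself, being the fixed point of s -> 1 + s^2 / 4. *)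
  - rewrite gf_all_eq.
    eapply Rle_trans; [apply psum_fmaj_add_le; lra|].
    rewrite psum_fmaj_const, Rabs_R1, psum_fmaj_X.
    pose proof (psum_fmaj_mul_le (/ 4) gf_all gf_all N ltac:(lra)).
    assert (0 <= psum (fmaj (/ 4) gf_all) N)
      by (apply psum_ge0; intros; apply fmaj_ge0; lra).
    nra.
Qed.

(* Strictly below 2 because some trees have register function [>= r]. *)
Lemma psum_gf_reg_lt r :
  exists beta, beta < 2 /\ forall N, psum (fmaj (/ 4) (gf_reg_lt r)) N <= beta.
Proof.
  destruct (gf_reg_pos r) as [m Hm].
  assert (Hd : 0 < fmaj (/ 4) (gf_reg r) m).
  { unfold fmaj; apply Rmult_lt_0_compat; [apply Rabs_pos_lt; lra|].
    apply pow_lt; lra. }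
  exists (2 - fmaj (/ 4) (gf_reg r) m); split; [lra|intros N].
  assert (Hpos : forall a n, 0 <= fmaj (/ 4) a n)
    by (intros; apply fmaj_ge0; lra).
  (* Extending the sum to [N + m] makes it include index [m], where [gf_reg r] takes a fixed amount
     away from the bound 2. *)
  pose proof (psum_mono _ N (N + m)%nat (Hpos (gf_reg_lt r)) ltac:(lia)).
  pose proof (psum_ge_term _ m (N + m)%nat (Hpos (gf_reg r)) ltac:(lia)).
  pose proof (psum_gf_all_le (N + m)%nat).
  assert (psum (fmaj (/ 4) (gf_reg_lt r)) (N + m)%nat
          + psum (fmaj (/ 4) (gf_reg r)) (N + m)%nat
          <= psum (fmaj (/ 4) gf_all) (N + m)%nat); [|lra].
  rewrite <- psum_add; apply psum_le; intros n; unfold fadd, fmaj.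
  rewrite <- Rmult_plus_distr_r; apply Rmult_le_compat_r; [apply pow_le; lra|].
  rewrite !Rabs_pos_eq by
    (apply gf_reg_ge0 || apply gf_reg_lt_ge0 || (apply tsum_ge0; intros; lra)).
  unfold gf_reg_lt, gf_reg, gf_all, tsum; rewrite <- lsum_map_add.
  apply lsum_map_le; intros t; nat_cases; simpl; lra || lia.
Qed.

(** At 1/4 the factor 2z is 1/2 and [gf_reg_lt r] sums to less than 2, so the geometric series
    converges even beyond 1/4. For [gf_all] the product would reach 1, which is the Catalan
    singularity. *)
Lemma small_inv_gf_reg_lt r :
  small (gf_reg_lt r) ->
  exists Y, small Y /\ (Y * (1 - 2 * fX * gf_reg_lt r) = 1)%fps.
Proof.
  intros Hs; destruct (psum_gf_reg_lt r) as [beta [Hbeta H]].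
  set (b := (fX * (fconst 2 * gf_reg_lt r))%fps).
  assert (Hb0 : b O = 0) by apply fmul_X_0.
  exists (finv1m b); split.
  - apply small_finv1m with (beta / 2); auto; [|lra|].
    + unfold b; repeat (apply small_mul || apply small_X || apply small_const);
        assumption.
    + assert (Hpos : forall a n, 0 <= fmaj (/ 4) a n)
        by (intros; apply fmaj_ge0; lra).
      intros N; eapply Rle_trans;
        [apply (psum_mono _ N (S N)); [apply Hpos|lia]|].
      unfold b; rewrite psum_fmaj_X.
      pose proof (psum_fmaj_mul_le (/ 4) (fconst 2) (gf_reg_lt r) N ltac:(lra)) as H1.
      rewrite psum_fmaj_const, (Rabs_pos_eq 2) in H1 by lra.
      specialize (H N); lra.
  - transitivity (finv1m b * (1 - b))%fps; [|now apply finv1mP].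
    unfold b; rewrite fconst_2; ring.
Qed.

(** The two claims feed each other: [gf_reg_lt (S r)] is a sum of known series, its factor is then
    invertible, and [gf_reg (S r)] is [gf_bottom (S r)] times that inverse. *)
Lemma small_gf_reg r : small (gf_reg_lt r) /\ small (gf_reg r).
Proof.
  assert (Hstep : forall r, small (gf_reg_lt r) -> small (gf_bottom r) ->
                            small (gf_reg r)).
  { clear r; intros r H1 H2; destruct (small_inv_gf_reg_lt r H1) as [Y [HY E]].
    replace (gf_reg r) with (gf_bottom r * Y)%fps; [now apply small_mul|].
    rewrite <- gf_reg_bottom.
    transitivity (gf_reg r * (Y * (1 - 2 * fX * gf_reg_lt r)))%fps; [ring|].
    rewrite E; ring. }
  induction r as [|r [IH1 IH2]].
  - split; [rewrite gf_reg_lt_0|rewrite gf_reg_0]; apply small_const.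
  - assert (small (gf_reg_lt (S r)))
      by (rewrite gf_reg_lt_S; now apply small_add).
    split; [assumption|apply Hstep; [assumption|]].
    simpl; repeat apply small_mul; auto using small_X.
Qed.

(** * Expansion at the dominant singularity *)

Definition eps_poly (a0 a1 a2 a3 : R) : fps :=
  (fconst a0 + feps * (fconst a1 + feps * (fconst a2 + feps * fconst a3)))%fps.

Definition feps4 : fps := (feps * (feps * (feps * feps)))%fps.

(* With [z = u / (1 + u)^2] and [u = exp (- tau)] one has
   [gf_bottom r = sinh^2 tau / sinh^2 (2^(r-1) tau)] and
   [1 - 4 z = tanh^2 (tau / 2)]; these are the first Taylor coefficients of the
   former in the latter, for [q = 4^r]. *)
Definition bottom_coef0 (q : R) : R := / q.
Definition bottom_coef1 (q : R) : R := / (3 * q) - / 3.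
Definition bottom_coef2 (q : R) : R := 4 / (15 * q) - / 3 + q / 15.
Definition bottom_coef3 (q : R) : R :=
  44 / (189 * q) - / 3 + q / 9 - 2 * q ^ 2 / 189.

Definition bottom_poly (q : R) : fps :=
  eps_poly (bottom_coef0 q) (bottom_coef1 q) (bottom_coef2 q) (bottom_coef3 q).

Ltac prove_small :=
  repeat (assumption || apply small_const || apply small_eps || apply small_X
          || apply small_sub || apply small_add || apply small_mul
          || apply small_opp).

Ltac fconst_field :=
  repeat (rewrite <- ?fconst_add, <- ?fconst_mul, <- ?fconst_sub);
  f_equal; unfold bottom_coef0, bottom_coef1, bottom_coef2, bottom_coef3; field.

Lemma small_eps_poly a0 a1 a2 a3 : small (eps_poly a0 a1 a2 a3).
Proof. unfold eps_poly; prove_small. Qed.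

Lemma four_X : (4 * fX = 1 - feps)%fps.
Proof. unfold feps; ring. Qed.

(** Multiplied by 4, with 4z = 1 - e, the recursion becomes a polynomial identity in e. The
    hypotheses make the coefficients of e^0 to e^3 vanish; [W] gathers those of e^4 to e^7. *)
Lemma eps_poly_step a0 a1 a2 a3 b0 b1 b2 b3 :
  (fconst a0 * fconst a0 - 4 * (fconst b0 * fconst a0) = 0)%fps ->
  (2 * fconst a0 * fconst a1 - fconst a0 * fconst a0
   - 4 * (fconst b0 * (fconst a1 - fconst a0 + 1) + fconst b1 * fconst a0)
   = 0)%fps ->
  (2 * fconst a0 * fconst a2 + fconst a1 * fconst a1 - 2 * fconst a0 * fconst a1
   - 4 * (fconst b0 * (fconst a2 - fconst a1)
          + fconst b1 * (fconst a1 - fconst a0 + 1) + fconst b2 * fconst a0)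
   = 0)%fps ->
  (2 * fconst a0 * fconst a3 + 2 * fconst a1 * fconst a2
   - (2 * fconst a0 * fconst a2 + fconst a1 * fconst a1)
   - 4 * (fconst b0 * (fconst a3 - fconst a2) + fconst b1 * (fconst a2 - fconst a1)
          + fconst b2 * (fconst a1 - fconst a0 + 1) + fconst b3 * fconst a0)
   = 0)%fps ->
  let p := eps_poly a0 a1 a2 a3 in let p' := eps_poly b0 b1 b2 b3 in
  exists W, small W /\
    ((1 - feps) * (p * p) - 4 * p' * (feps + (1 - feps) * p) = feps4 * W)%fps.
Proof.
  unfold eps_poly.
  set (A0 := fconst a0); set (A1 := fconst a1); set (A2 := fconst a2);
    set (A3 := fconst a3); set (B0 := fconst b0); set (B1 := fconst b1);
    set (B2 := fconst b2); set (B3 := fconst b3).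
  intros C0 C1 C2 C3; cbv zeta.
  exists
    ((2 * A1 * A3 + A2 * A2 - (2 * A0 * A3 + 2 * A1 * A2)
      - 4 * (B0 * - A3 + B1 * (A3 - A2) + B2 * (A2 - A1) + B3 * (A1 - A0 + 1)))
     + feps * ((2 * A2 * A3 - (2 * A1 * A3 + A2 * A2)
                - 4 * (B1 * - A3 + B2 * (A3 - A2) + B3 * (A2 - A1)))
     + feps * ((A3 * A3 - 2 * A2 * A3 - 4 * (B2 * - A3 + B3 * (A3 - A2)))
     + feps * (- (A3 * A3) - 4 * (B3 * - A3)))))%fps.
  split.
  - subst A0 A1 A2 A3 B0 B1 B2 B3; prove_small.
  (* Four zero coefficients are inserted so that each can be replaced by the left side of one
     hypothesis. *)
  - match goal with |- ?u = ?v => transitivity (0 + feps * (0 + feps * (0 +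
      feps * 0)) + v)%fps; [|ring] end.
    rewrite <- C0 at 1; rewrite <- C1 at 1; rewrite <- C2 at 1;
      rewrite <- C3 at 1; unfold feps4; ring.
Qed.

Lemma gf_bottom_expansion r :
  exists H, small H /\ (gf_bottom r = bottom_poly (4 ^ r) + feps4 * H)%fps.
Proof.
  induction r as [|r [H [HH E]]].
  - exists 0%fps; split; [apply small_const|].
    simpl gf_bottom; simpl pow; unfold bottom_poly, eps_poly.
    replace (bottom_coef0 1) with 1 by (unfold bottom_coef0; field).
    replace (bottom_coef1 1) with 0 by (unfold bottom_coef1; field).
    replace (bottom_coef2 1) with 0 by (unfold bottom_coef2; field).
    replace (bottom_coef3 1) with 0 by (unfold bottom_coef3; field).
    ring.
  - assert (Hq : 4 ^ r <> 0) by (apply pow_nonzero; lra).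
    simpl pow; set (q := 4 ^ r) in *.
    (* Passing to [S r] replaces q by 4q; the coefficient formulas satisfy the four conditions as
       rational identities in q. *)
    destruct (eps_poly_step (bottom_coef0 q) (bottom_coef1 q) (bottom_coef2 q)
      (bottom_coef3 q) (bottom_coef0 (4 * q)) (bottom_coef1 (4 * q))
      (bottom_coef2 (4 * q)) (bottom_coef3 (4 * q))) as [W [HW EW]];
      try (fconst_field; assumption).
    fold (bottom_poly q) (bottom_poly (4 * q)) in EW.
    destruct (small_inv_gf_reg_lt r (proj1 (small_gf_reg r))) as [Y [HY EY]].
    set (p := bottom_poly q) in *; set (p' := bottom_poly (4 * q)) in *.
    (* The defect of [p'] in the recursion, divided by e^4, once [p] is replaced by the true series
       [p + feps4 * H]. Division by 4(e + 4zN) = 4y^2 is multiplication by [fconst (/ 4)] and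
       [Y * Y]. *)
    set (G := (W + H * ((1 - feps) * (2 * p + feps4 * H - 4 * p')))%fps).
    exists (fconst (/ 4) * G * (Y * Y))%fps; split.
    + assert (small p) by apply small_eps_poly.
      assert (small p') by apply small_eps_poly.
      unfold G, feps4; prove_small.
    + pose proof (gf_bottom_S r) as E1.
      set (y := (1 - 2 * fX * gf_reg_lt r)%fps) in *.
      pose proof (gf_reg_lt_quadratic r : (y * y = _)%fps) as E2.
      set (N := gf_bottom r) in *; set (N' := gf_bottom (S r)) in *.
      assert (E3 : (fconst (/ 4) * 4 = 1)%fps)
        by (rewrite <- fconst_4, <- fconst_mul; f_equal; field).
      assert (E4 : ((1 - feps) * (N * N) - 4 * p' * (feps + (1 - feps) * N)
                    = feps4 * G)%fps).
      { rewrite E; unfold G.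
        match type of EW with ?u = _ =>
          transitivity (u + feps4 * (H * ((1 - feps)
                              * (2 * p + feps4 * H - 4 * p'))))%fps end;
          [ring|rewrite EW; ring]. }
      assert (E5 : ((N' - p') * (y * y) = fconst (/ 4) * (feps4 * G))%fps).
      { rewrite <- E4.
        transitivity (N' * (y * y) - p' * (y * y))%fps; [ring|].
        rewrite E1, E2.
        transitivity (fconst (/ 4) * 4
                      * (fX * (N * N) - p' * (feps + 4 * fX * N)))%fps;
          [rewrite E3; ring|].
        rewrite <- four_X; ring. }
      transitivity (p' + (N' - p') * (y * y) * (Y * Y))%fps.
      * transitivity (p' + (N' - p') * ((Y * y) * (Y * y)))%fps; [|ring].
        rewrite EY; ring.
      * rewrite E5; ring.
Qed.

(** * Coefficients of the half-integer powers of [1 - 4 z] *)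

Definition fsqrt : fps := (1 - 2 * fX * gf_all)%fps.

Lemma fsqrt_sqr : (fsqrt * fsqrt = feps)%fps.
Proof.
  unfold fsqrt, feps.
  transitivity (1 - 4 * fX * (gf_all - fX * (gf_all * gf_all)))%fps; [ring|].
  rewrite gf_all_eq at 1; ring.
Qed.

Lemma feps_mul_0 a : (feps * a)%fps O = a O.
Proof.
  rewrite fmul_0; unfold feps, fsub, fadd, fopp; rewrite fmul_0; simpl; ring.
Qed.

Lemma feps_mul_S a n : (feps * a)%fps (S n) = a (S n) - 4 * a n.
Proof.
  unfold feps; rewrite <- fconst_4.
  replace ((1 - fconst 4 * fX) * a)%fps
    with (a - fconst 4 * (fX * a))%fps by ring.
  unfold fsub, fadd, fopp; rewrite fmul_const, fmul_X_S; ring.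
Qed.

Lemma fsqrt_0 : fsqrt O = 1.
Proof.
  unfold fsqrt, fsub, fadd, fopp; rewrite !fmul_0; simpl; ring.
Qed.

Lemma fsqrt_S n : fsqrt (S n) = - 2 * gf_all n.
Proof.
  unfold fsqrt; rewrite <- fconst_2.
  replace (fconst 2 * fX * gf_all)%fps
    with (fconst 2 * (fX * gf_all))%fps by ring.
  unfold fsub, fadd, fopp; rewrite fmul_const, fmul_X_S; simpl; ring.
Qed.

(** The Euler derivation of [fsqrt_sqr] gives [fsqrt * feuler fsqrt = fconst (-2) * fX]; one more
    factor [fsqrt] makes the equation linear. Its coefficients yield the Catalan recurrence
    [gf_all_S]. *)
Lemma fsqrt_ode : (feps * feuler fsqrt = fconst (-2) * (fX * fsqrt))%fps.
Proof.
  assert (E : (fsqrt * feuler fsqrt = fconst (-2) * fX)%fps).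
  { pose proof (feuler_mul fsqrt fsqrt) as E.
    rewrite fsqrt_sqr in E.
    apply functional_extensionality; intros n.
    apply (f_equal (fun f : fps => f n)) in E.
    rewrite (fmul_comm (feuler fsqrt)) in E; unfold fadd in E.
    rewrite fmul_const.
    assert (feuler feps n = - 4 * fX n); [|lra].
    unfold feuler, feps; rewrite <- fconst_4.
    unfold fsub, fadd, fopp; rewrite fmul_const.
    destruct n as [|[|n]]; simpl; ring. }
  rewrite <- fsqrt_sqr.
  transitivity (fsqrt * (fsqrt * feuler fsqrt))%fps; [ring|].
  rewrite E; ring.
Qed.

Lemma gf_all_0 : gf_all O = 1.
Proof. unfold gf_all, tsum; simpl; ring. Qed.

Lemma gf_all_S n : (INR n + 2) * gf_all (S n) = (4 * INR n + 2) * gf_all n.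
Proof.
  pose proof (f_equal (fun f : fps => f (S (S n))) fsqrt_ode) as E.
  simpl in E; rewrite feps_mul_S, fmul_const, fmul_X_S in E.
  unfold feuler in E; rewrite !fsqrt_S, !S_INR in E; lra.
Qed.

Lemma gf_all_pos n : 0 < gf_all n.
Proof.
  induction n as [|n IH]; [rewrite gf_all_0; lra|].
  pose proof (gf_all_S n); pose proof (pos_INR n).
  apply Rmult_lt_reg_l with (INR n + 2); [lra|].
  rewrite Rmult_0_r, H; apply Rmult_lt_0_compat; lra.
Qed.

(** The central binomial coefficients, series of (1 - 4z)^(-1/2), written through Catalan numbers
    because every moment is divided by one; [finv_sqrt_cube] likewise is (1 - 4z)^(-3/2). *)
Definition finv_sqrt : fps := fun n => (INR n + 1) * gf_all n.
Definition finv_sqrt_cube : fps := fun n => (2 * INR n + 1) * (INR n + 1) * gf_all n.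

Lemma feps_finv_sqrt : (feps * finv_sqrt = fsqrt)%fps.
Proof.
  apply functional_extensionality; intros [|n].
  - rewrite feps_mul_0, fsqrt_0; unfold finv_sqrt; rewrite gf_all_0; simpl; ring.
  - rewrite feps_mul_S, fsqrt_S; unfold finv_sqrt; rewrite S_INR.
    pose proof (gf_all_S n); lra.
Qed.

Lemma feps_finv_sqrt_cube : (feps * finv_sqrt_cube = finv_sqrt)%fps.
Proof.
  apply functional_extensionality; intros [|n].
  - rewrite feps_mul_0; unfold finv_sqrt, finv_sqrt_cube; simpl; ring.
  - rewrite feps_mul_S; unfold finv_sqrt, finv_sqrt_cube; rewrite S_INR.
    pose proof (gf_all_S n).
    replace (4 * ((2 * INR n + 1) * (INR n + 1) * gf_all n))
      with (2 * (INR n + 1) * ((4 * INR n + 2) * gf_all n)) by ring.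
    rewrite <- H; ring.
Qed.

Lemma fsqrt_finv_sqrt : (fsqrt * finv_sqrt = 1)%fps.
Proof.
  pose proof (finv1mP (4 * fX)%fps ltac:(rewrite !fmul_0; simpl; ring)) as Ei.
  fold feps in Ei.
  transitivity (finv1m (4 * fX) * feps * (fsqrt * finv_sqrt))%fps;
    [rewrite Ei; ring|].
  transitivity (finv1m (4 * fX) * (fsqrt * (feps * finv_sqrt)))%fps; [ring|].
  rewrite feps_finv_sqrt, fsqrt_sqr; exact Ei.
Qed.

Lemma finv_sqrt_cubeE : (finv_sqrt * (finv_sqrt * finv_sqrt) = finv_sqrt_cube)%fps.
Proof.
  rewrite <- feps_finv_sqrt_cube at 1.
  transitivity (feps * finv_sqrt * finv_sqrt * finv_sqrt_cube)%fps; [ring|].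
  rewrite feps_finv_sqrt, fsqrt_finv_sqrt; ring.
Qed.

(* Represents [(1 - 4 z)^(j - 1/2)]. *)
Fixpoint half_pow (j : nat) : fps :=
  match j with O => finv_sqrt | S i => fmul feps (half_pow i) end.

Lemma half_pow_0 j : half_pow j O = 1.
Proof.
  induction j as [|j IH]; simpl.
  - unfold finv_sqrt; rewrite gf_all_0; simpl; ring.
  - now rewrite feps_mul_0.
Qed.

Lemma half_odd_neq0 n j : 2 * INR n + 1 - 2 * INR j <> 0.
Proof.
  intros H; assert (E : INR (2 * n + 1) = INR (2 * j)).
  { rewrite plus_INR, !mult_INR; simpl; lra. }
  apply INR_eq in E; lia.
Qed.

(** The induction on [j] alternates: the first relation at [j] gives the second, which used at [n]
    and [S n] gives the first at [S j] after cancelling an odd, hence nonzero, factor. *)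
Lemma half_pow_spec j n :
  (INR n + 1) * half_pow j (S n) = 2 * (2 * INR n + 1 - 2 * INR j) * half_pow j n
  /\ (2 * INR n - 1 - 2 * INR j) * half_pow (S j) n
     = - (2 * INR j + 1) * half_pow j n.
Proof.
  revert n.
  assert (Hd : forall j, (forall n, (INR n + 1) * half_pow j (S n)
                 = 2 * (2 * INR n + 1 - 2 * INR j) * half_pow j n) ->
               forall n, (2 * INR n - 1 - 2 * INR j) * half_pow (S j) n
                 = - (2 * INR j + 1) * half_pow j n).
  { clear j; intros j H [|n]; simpl half_pow.
    - rewrite feps_mul_0; simpl; ring.
    - rewrite feps_mul_S, S_INR; specialize (H n); lra. }
  assert (Hr : forall n, (INR n + 1) * half_pow j (S n)
                 = 2 * (2 * INR n + 1 - 2 * INR j) * half_pow j n).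
  { induction j as [|j IH]; intros n.
    - simpl half_pow; unfold finv_sqrt; rewrite S_INR.
      replace ((INR n + 1 + 1) * gf_all (S n)) with ((INR n + 2) * gf_all (S n))
        by ring.
      rewrite gf_all_S; simpl; ring.
    - pose proof (Hd j IH n) as H1; pose proof (Hd j IH (S n)) as H2.
      specialize (IH n); rewrite S_INR in *.
      pose proof (half_odd_neq0 n j) as Hne.
      apply Rmult_eq_reg_l with (2 * INR n + 1 - 2 * INR j); [|assumption].
      transitivity ((INR n + 1)
        * ((2 * (INR n + 1) - 1 - 2 * INR j) * half_pow (S j) (S n))); [ring|].
      rewrite H2.
      transitivity (- (2 * INR j + 1) * ((INR n + 1) * half_pow j (S n)));
        [ring|].
      rewrite IH.
      transitivity (2 * (2 * INR n + 1 - 2 * INR j)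
        * (- (2 * INR j + 1) * half_pow j n)); [ring|].
      rewrite <- H1; ring. }
  intros n; split; [apply Hr|now apply Hd].
Qed.

Lemma half_pow_neq0 j n : half_pow j n <> 0.
Proof.
  induction n as [|n IH]; [rewrite half_pow_0; lra|].
  intros H; destruct (half_pow_spec j n) as [E _]; rewrite H, Rmult_0_r in E.
  symmetry in E; apply Rmult_integral in E; destruct E as [E|E]; [|now apply IH].
  apply (half_odd_neq0 n j); lra.
Qed.

(** Successive coefficients have ratio tending to 4, which exceeds 1 / x; weighted by x^k they are
    eventually nondecreasing in absolute value. *)
Lemma half_pow_ratio j x :
  / 4 < x -> exists k0, forall k, (k0 <= k)%nat ->
    Rabs (half_pow j k) <= x * Rabs (half_pow j (S k)).
Proof.
  (* The threshold solves k + 1 <= 2x(2k + 1 - 2j) for k, with 2x to spare; adding [j] below keeps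
     the factor 2k + 1 - 2j positive. *)
  intros Hx; destruct (INR_unbounded ((1 + 4 * INR j * x) / (4 * x - 1))) as [m Hm].
  exists (m + j)%nat; intros k Hk.
  apply le_INR in Hk; rewrite plus_INR in Hk.
  pose proof (pos_INR j); pose proof (pos_INR m); pose proof (pos_INR k).
  destruct (half_pow_spec j k) as [E _].
  apply (f_equal Rabs) in E; rewrite !Rabs_mult in E.
  rewrite (Rabs_pos_eq (INR k + 1)), (Rabs_pos_eq 2),
    (Rabs_pos_eq (2 * INR k + 1 - 2 * INR j)) in E by lra.
  assert (Hm' : 1 + 4 * INR j * x < INR k * (4 * x - 1)).
  { apply Rlt_le_trans with (INR m * (4 * x - 1));
      [|apply Rmult_le_compat_r; lra].
    apply Rmult_lt_reg_r with (/ (4 * x - 1)); [apply Rinv_0_lt_compat; lra|].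
    replace (INR m * (4 * x - 1) * / (4 * x - 1)) with (INR m) by (field; lra).
    exact Hm. }
  apply Rmult_le_reg_l with (INR k + 1); [lra|].
  replace ((INR k + 1) * (x * Rabs (half_pow j (S k))))
    with (x * ((INR k + 1) * Rabs (half_pow j (S k)))) by ring.
  rewrite E, <- !Rmult_assoc; apply Rmult_le_compat_r; [apply Rabs_pos|lra].
Qed.

Lemma eventually_mono_bound (f : fps) k0 :
  (forall k, 0 < f k) -> (forall k, (k0 <= k)%nat -> f k <= f (S k)) ->
  exists K, 0 <= K /\ forall k n, (k <= n)%nat -> f k <= K * f n.
Proof.
  revert f; induction k0 as [|k0 IH]; intros f Hpos Hf.
  - exists 1; split; [lra|]; intros k n H; induction H as [|n H IHn]; [lra|].
    specialize (Hf n ltac:(lia)); lra.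
  - destruct (IH (ftail f)) as [K [HK0 HK]];
      [intros; apply Hpos|intros; apply Hf; lia|].
    set (c := f O / f 1%nat).
    assert (Hc : 0 < c) by (apply Rdiv_lt_0_compat; apply Hpos).
    assert (Ec : f O = c * f 1%nat)
      by (unfold c; field; apply Rgt_not_eq, Hpos).
    assert (0 <= c * K) by (apply Rmult_le_pos; lra).
    exists (1 + K + c * K); split; [lra|]; intros k [|n] H1.
    + assert (k = O) as -> by lia; pose proof (Hpos O); nra.
    + pose proof (Hpos (S n)) as Hn.
      assert (H2 : forall i, (i <= n)%nat -> f (S i) <= K * f (S n))
        by (intros; now apply (HK i n)).
      assert (0 <= K * f (S n)) by (apply Rmult_le_pos; lra).
      assert (0 <= c * K * f (S n)) by (apply Rmult_le_pos; lra).
      destruct k as [|k].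
      * specialize (H2 O ltac:(lia)).
        apply (Rmult_le_compat_l c) in H2; lra.
      * specialize (H2 k ltac:(lia)); lra.
Qed.

Lemma fmul_le_psum f g c n :
  (forall k, (k <= n)%nat -> f k <= c) -> (forall k, 0 <= g k) ->
  fmul f g n <= c * psum g n.
Proof.
  intros Hf Hg; revert f Hf; induction n as [|n IH]; intros f Hf.
  - rewrite fmul_0; simpl; apply Rmult_le_compat_r; auto.
  - rewrite fmul_S, psum_recr.
    assert (f O * g (S n) <= c * g (S n))
      by (apply Rmult_le_compat_r; [auto|apply Hf; lia]).
    assert (fmul (ftail f) g n <= c * psum g n)
      by (apply IH; intros; apply Hf; lia).
    lra.
Qed.

(** Weighted by powers of x, the values of [half_pow j] up to n are at most a constant times the one
    at n, while those of [H] have bounded sum; the convolution is at most the product of both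
    bounds. *)
Lemma half_pow_mul_small j H :
  small H -> exists K, forall n, Rabs ((half_pow j * H)%fps n) <= K * Rabs (half_pow j n).
Proof.
  intros [x [Hx [L HL]]].
  destruct (half_pow_ratio j x Hx) as [k0 Hk0].
  destruct (eventually_mono_bound (fmaj x (half_pow j)) k0) as [K [HK0 HK]].
  - intros k; unfold fmaj; apply Rmult_lt_0_compat;
      [apply Rabs_pos_lt, half_pow_neq0|].
    apply pow_lt; lra.
  - intros k Hk; unfold fmaj; simpl.
    specialize (Hk0 k Hk).
    assert (0 < x ^ k) by (apply pow_lt; lra).
    replace (Rabs (half_pow j (S k)) * (x * x ^ k))
      with (x * Rabs (half_pow j (S k)) * x ^ k) by ring.
    apply Rmult_le_compat_r; lra.
  - exists (K * L); intros n.
    assert (Hxn : 0 < x ^ n) by (apply pow_lt; lra).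
    apply Rmult_le_reg_r with (x ^ n); [assumption|].
    eapply Rle_trans; [apply (fmaj_mul_le x (half_pow j) H n); lra|].
    eapply Rle_trans; [apply (fmul_le_psum _ _ (K * fmaj x (half_pow j) n))|].
    + intros; now apply HK.
    + intros; apply fmaj_ge0; lra.
    + assert (0 <= K * fmaj x (half_pow j) n)
        by (apply Rmult_le_pos; [|apply fmaj_ge0]; lra).
      specialize (HL n).
      apply Rle_trans with (K * fmaj x (half_pow j) n * L);
        [now apply Rmult_le_compat_l|].
      unfold fmaj; lra.
Qed.

(** * Asymptotics *)

Definition bigO (k : nat) (f : nat -> R) : Prop :=
  exists C, exists N : nat, forall n, (N <= n)%nat -> Rabs (f n) <= C / INR n ^ k.

Lemma bigO_ext k f g N :
  (forall n, (N <= n)%nat -> f n = g n) -> bigO k g -> bigO k f.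
Proof.
  intros E [C [M H]]; exists C, (Nat.max N M); intros n Hn.
  rewrite E by lia; apply H; lia.
Qed.

Lemma bigO_add k f g : bigO k f -> bigO k g -> bigO k (fun n => f n + g n).
Proof.
  intros [C [M H]] [D [N H']]; exists (C + D), (Nat.max N M); intros n Hn.
  eapply Rle_trans; [apply Rabs_triang|].
  specialize (H n ltac:(lia)); specialize (H' n ltac:(lia)).
  unfold Rdiv in *; lra.
Qed.

Lemma bigO_mul j k f g :
  bigO j f -> bigO k g -> bigO (j + k) (fun n => f n * g n).
Proof.
  intros [C [M H]] [D [N H']]; exists (C * D), (Nat.max N (Nat.max M 1)).
  intros n Hn; specialize (H n ltac:(lia)); specialize (H' n ltac:(lia)).
  assert (0 < INR n) by (apply lt_0_INR; lia).
  replace (C * D / INR n ^ (j + k)) with (C / INR n ^ j * (D / INR n ^ k)).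
  - rewrite Rabs_mult; apply Rmult_le_compat; auto using Rabs_pos.
  - rewrite pow_add; field; split; apply pow_nonzero; lra.
Qed.

Lemma bigO_const c : bigO 0 (fun _ => c).
Proof. exists (Rabs c), O; intros; simpl; lra. Qed.

Lemma bigO_scal k c f : bigO k f -> bigO k (fun n => c * f n).
Proof. apply (bigO_mul 0 k (fun _ => c) f), bigO_const. Qed.

Lemma bigO_inv : bigO 1 (fun n => / INR n).
Proof.
  exists 1, 1%nat; intros n Hn.
  assert (0 < INR n) by (apply lt_0_INR; lia).
  rewrite Rabs_pos_eq by (left; now apply Rinv_0_lt_compat).
  simpl; unfold Rdiv; rewrite Rmult_1_r; lra.
Qed.

Lemma bigO_inv_affine c : bigO 1 (fun n => / (2 * INR n - INR c)).
Proof.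
  exists 1, (S c); intros n Hn.
  apply le_INR in Hn; rewrite S_INR in Hn; pose proof (pos_INR c).
  rewrite Rabs_pos_eq by (left; apply Rinv_0_lt_compat; lra).
  simpl; unfold Rdiv; rewrite Rmult_1_r, Rmult_1_l.
  apply Rinv_le_contravar; lra.
Qed.

Lemma bigO_weaken k f : bigO (S k) f -> bigO k f.
Proof.
  intros [C [N H]]; exists (Rabs C), (Nat.max N 1); intros n Hn.
  specialize (H n ltac:(lia)); eapply Rle_trans; [exact H|].
  assert (H1 : 1 <= INR n) by (apply (le_INR 1); lia).
  assert (0 < INR n ^ k) by (apply pow_lt; lra).
  unfold Rdiv; simpl.
  rewrite Rinv_mult.
  assert (0 < / INR n ^ k) by now apply Rinv_0_lt_compat.
  assert (/ INR n <= 1) by (rewrite <- Rinv_1; apply Rinv_le_contravar; lra).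
  assert (0 < / INR n) by (apply Rinv_0_lt_compat; lra).
  pose proof (Rle_abs C); pose proof (Rabs_pos C).
  apply Rle_trans with (Rabs C * (/ INR n * / INR n ^ k)).
  - apply Rmult_le_compat_r; [|assumption].
    left; now apply Rmult_lt_0_compat.
  - apply Rmult_le_compat_l; [assumption|].
    apply Rle_trans with (1 * / INR n ^ k); [|lra].
    apply Rmult_le_compat_r; lra.
Qed.

Lemma bigO_inv_pow k : bigO k (fun n => / INR n ^ k).
Proof.
  exists 1, 1%nat; intros n Hn.
  assert (0 < INR n ^ k) by (apply pow_lt, lt_0_INR; lia).
  rewrite Rabs_pos_eq by (left; now apply Rinv_0_lt_compat).
  unfold Rdiv; lra.
Qed.

Lemma bigO_opp k f : bigO k f -> bigO k (fun n => - f n).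
Proof.
  intros [C [N H]]; exists C, N; intros; rewrite Rabs_Ropp; auto.
Qed.

Lemma bigO_affine_mul k a b f :
  bigO (S k) f -> bigO k (fun n => (a * INR n + b) * f n).
Proof.
  intros H; apply bigO_ext with (N := 1%nat)
    (g := fun n => INR n * (a * f n) + b * f n); [intros; ring|].
  apply bigO_add; [|now apply bigO_scal, bigO_weaken].
  apply (bigO_scal _ a) in H; destruct H as [C [N H]].
  exists C, (Nat.max N 1); intros n Hn; specialize (H n ltac:(lia)).
  assert (0 < INR n) by (apply lt_0_INR; lia).
  rewrite Rabs_mult, (Rabs_pos_eq (INR n)) by lra.
  replace (C / INR n ^ k) with (INR n * (C / INR n ^ S k)).
  - apply Rmult_le_compat_l; lra.
  - simpl; field; split; [apply pow_nonzero|]; lra.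
Qed.

(** * Half-integer powers measured against the Catalan numbers *)

Definition half_ratio (j n : nat) : R := half_pow j n / gf_all n.

Lemma half_ratio_0 n : half_ratio 0 n = INR n + 1.
Proof.
  unfold half_ratio; simpl; unfold finv_sqrt; field.
  apply Rgt_not_eq, gf_all_pos.
Qed.

Lemma half_ratio_S j n :
  half_ratio (S j) n
  = - (2 * INR j + 1) / (2 * INR n - INR (2 * j + 1)) * half_ratio j n.
Proof.
  assert (E : 2 * INR n - INR (2 * j + 1) = 2 * INR n + 1 - 2 * INR (S j))
    by (rewrite plus_INR, mult_INR, (S_INR j); simpl; ring).
  destruct (half_pow_spec j n) as [_ H].
  pose proof (half_odd_neq0 n (S j)) as Hne; rewrite <- E in Hne.
  pose proof (gf_all_pos n); unfold half_ratio.
  apply Rmult_eq_reg_l with ((2 * INR n - INR (2 * j + 1)) * gf_all n);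
    [|apply Rmult_integral_contrapositive; split; lra].
  transitivity ((2 * INR n - INR (2 * j + 1)) * half_pow (S j) n);
    [field; lra|].
  transitivity (- (2 * INR j + 1) * half_pow j n); [|field; lra].
  rewrite <- H, E, S_INR; ring.
Qed.

(** The ratio for [S O] is bounded, and each further power of e brings a denominator linear in n. *)
Lemma bigO_half_ratio j : bigO j (fun n => half_ratio (S j) n).
Proof.
  induction j as [|j IH].
  - apply bigO_ext with (N := 1%nat)
      (g := fun n => - / 2 * (1 + 3 * / (2 * INR n - INR 1))).
    + intros n Hn; rewrite half_ratio_S, half_ratio_0; simpl.
      apply le_INR in Hn; simpl in Hn; field; lra.
    + apply bigO_scal, bigO_add; [apply bigO_const|].
      apply bigO_scal, bigO_weaken, bigO_inv_affine.
  - apply bigO_ext with (N := O)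
      (g := fun n => - (2 * INR (S j) + 1)
                     * (/ (2 * INR n - INR (2 * S j + 1)) * half_ratio (S j) n)).
    + intros n _; rewrite half_ratio_S; unfold Rdiv; ring.
    + apply bigO_scal, (bigO_mul 1 j); [apply bigO_inv_affine|exact IH].
Qed.

Lemma bigO_half_pow_mul j H :
  small H -> bigO j (fun n => (half_pow (S j) * H)%fps n / gf_all n).
Proof.
  intros HH; destruct (half_pow_mul_small (S j) H HH) as [K HK].
  destruct (bigO_half_ratio j) as [C [N HC]].
  exists (Rabs K * C), N; intros n Hn; specialize (HC n Hn); specialize (HK n).
  pose proof (gf_all_pos n) as Hc.
  unfold half_ratio, Rdiv in *; rewrite Rabs_mult in *.
  pose proof (Rle_abs K).
  assert (0 <= Rabs (/ gf_all n)) by apply Rabs_pos.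
  apply Rle_trans with
    (Rabs K * (Rabs (half_pow (S j) n) * Rabs (/ gf_all n))).
  - rewrite <- Rmult_assoc; apply Rmult_le_compat_r; [assumption|].
    eapply Rle_trans; [exact HK|].
    apply Rmult_le_compat_r; [apply Rabs_pos|assumption].
  - rewrite Rmult_assoc; apply Rmult_le_compat_l; [apply Rabs_pos|exact HC].
Qed.

(** The ratio is the rational function -(n + 1) / (2n - 1), and the [g] supplied is its exact
    difference from the truncation. The next two expansions work alike; the lower bounds on n keep
    the denominators positive. *)
Lemma half_ratio_1_expansion :
  bigO 3 (fun n => half_ratio 1 n
                   - (- / 2 - 3 / (4 * INR n) - 3 / (8 * INR n ^ 2))).
Proof.
  apply bigO_ext with (N := 1%nat)
    (g := fun n => - (3 / 8) * (/ INR n ^ 2 * / (2 * INR n - INR 1))).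
  - intros n Hn; rewrite half_ratio_S, half_ratio_0; simpl.
    apply le_INR in Hn; simpl in Hn; field; lra.
  - apply bigO_scal, (bigO_mul 2 1); [apply bigO_inv_pow|apply bigO_inv_affine].
Qed.

Lemma half_ratio_2_expansion :
  bigO 3 (fun n => half_ratio 2 n - (3 / (4 * INR n) + 9 / (4 * INR n ^ 2))).
Proof.
  apply bigO_ext with (N := 2%nat)
    (g := fun n => / INR n ^ 2 * (/ (2 * INR n - INR 1)
       * (63 / 8 + 135 / 8 * / (2 * INR n - INR 3)))).
  - intros n Hn; rewrite !half_ratio_S, half_ratio_0; simpl.
    apply le_INR in Hn; simpl in Hn; field; lra.
  - apply (bigO_mul 2 1); [apply bigO_inv_pow|].
    apply (bigO_mul 1 0); [apply bigO_inv_affine|].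
    apply bigO_add; [apply bigO_const|].
    apply bigO_scal, bigO_weaken, bigO_inv_affine.
Qed.

Lemma half_ratio_3_expansion :
  bigO 3 (fun n => half_ratio 3 n - - 15 / (8 * INR n ^ 2)).
Proof.
  apply bigO_ext with (N := 3%nat)
    (g := fun n => - (15 / 8) * (/ INR n ^ 2 * (/ (2 * INR n - INR 5)
       * (11 + / (2 * INR n - INR 1) * (21 + 45 * / (2 * INR n - INR 3)))))).
  - intros n Hn; rewrite !half_ratio_S, half_ratio_0; simpl.
    apply le_INR in Hn; simpl in Hn; field; lra.
  - apply bigO_scal, (bigO_mul 2 1); [apply bigO_inv_pow|].
    apply (bigO_mul 1 0); [apply bigO_inv_affine|].
    apply bigO_add; [apply bigO_const|].
    apply bigO_weaken, (bigO_mul 1 0); [apply bigO_inv_affine|].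
    apply bigO_add; [apply bigO_const|].
    apply bigO_scal, bigO_weaken, bigO_inv_affine.
Qed.

(** * Moments as quotients of coefficients, and their expansions *)

Lemma gf_all_length n : gf_all n = INR (length (trees n)).
Proof.
  unfold gf_all, tsum; induction (trees n) as [|t l IH]; [reflexivity|].
  change (length (t :: l)) with (S (length l)).
  rewrite S_INR, <- IH; unfold lsum; simpl; ring.
Qed.

Lemma E_nr_gf n r : E_nr n r = gf_branches r n / gf_all n.
Proof. rewrite gf_all_length; reflexivity. Qed.

Lemma V_nr_gf n r : V_nr n r = gf_branches_sqr r n / gf_all n - E_nr n r ^ 2.
Proof.
  pose proof (gf_all_pos n) as Hpos.
  pose proof (E_nr_gf n r) as HE.
  unfold V_nr, unif_mean; set (e := E_nr n r) in *.
  rewrite <- gf_all_length.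
  assert (Hs : fold_right Rplus 0
                 (map (fun t => (INR (branches r t) - e) ^ 2) (trees n))
               = gf_branches_sqr r n - 2 * e * gf_branches r n + e ^ 2 * gf_all n).
  { unfold gf_branches_sqr, gf_branches, gf_all, tsum.
    induction (trees n) as [|t l IH]; [simpl; ring|].
    cbn [map fold_right]; rewrite IH; unfold lsum; simpl; ring. }
  rewrite Hs.
  replace (gf_branches r n) with (e * gf_all n) by (rewrite HE; field; lra).
  field; lra.
Qed.

Lemma gf_branches_half r : gf_branches r = (gf_bottom r * finv_sqrt)%fps.
Proof.
  rewrite <- gf_branches_eq; fold fsqrt.
  transitivity (gf_branches r * (fsqrt * finv_sqrt))%fps; [|ring].
  rewrite fsqrt_finv_sqrt; ring.
Qed.

Lemma gf_branches_sqr_half r :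
  (gf_branches_sqr r
   = gf_branches r + 2 * fX * (gf_bottom r * gf_bottom r) * finv_sqrt_cube)%fps.
Proof.
  transitivity (gf_branches_sqr r * fsqrt * finv_sqrt)%fps.
  - transitivity (gf_branches_sqr r * (fsqrt * finv_sqrt))%fps; [|ring].
    rewrite fsqrt_finv_sqrt; ring.
  - unfold fsqrt; rewrite gf_branches_sqr_eq, gf_branches_half.
    rewrite <- finv_sqrt_cubeE; ring.
Qed.

Lemma E_nr_expansion r :
  let q := 4 ^ r in
  bigO 3 (fun n => E_nr n r
    - (bottom_coef0 q * half_ratio 0 n + bottom_coef1 q * half_ratio 1 n
       + bottom_coef2 q * half_ratio 2 n + bottom_coef3 q * half_ratio 3 n)).
Proof.
  intros q; destruct (gf_bottom_expansion r) as [H [HH E]]; fold q in E.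
  apply bigO_ext with (N := O) (g := fun n => (half_pow 4 * H)%fps n / gf_all n);
    [|now apply bigO_half_pow_mul].
  intros n _; rewrite E_nr_gf, gf_branches_half, E.
  replace ((bottom_poly q + feps4 * H) * finv_sqrt)%fps with
    (fconst (bottom_coef0 q) * half_pow 0 + fconst (bottom_coef1 q) * half_pow 1
     + fconst (bottom_coef2 q) * half_pow 2 + fconst (bottom_coef3 q) * half_pow 3
     + half_pow 4 * H)%fps
    by (unfold bottom_poly, eps_poly, feps4; simpl half_pow; ring).
  unfold fadd; rewrite !fmul_const; unfold half_ratio; field.
  apply Rgt_not_eq, gf_all_pos.
Qed.

(** With 2z = (1 - e) / 2, the coefficients are those of (1 - e) p^2 / 2, where p is
    [bottom_poly q]. The factor e^(-3/2) sends e^i to [half_pow (i - 1)] for i >= 1, so the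
    remainder starts at [half_pow 3], one order of n worse than for the mean. *)
Lemma branches_sqr_expansion r :
  let q := 4 ^ r in
  let a0 := bottom_coef0 q in let a1 := bottom_coef1 q in
  let a2 := bottom_coef2 q in let a3 := bottom_coef3 q in
  bigO 2 (fun n => gf_branches_sqr r n / gf_all n
    - (E_nr n r
       + a0 * a0 / 2 * ((2 * INR n + 1) * (INR n + 1))
       + (2 * a0 * a1 - a0 * a0) / 2 * half_ratio 0 n
       + (2 * a0 * a2 + a1 * a1 - 2 * a0 * a1) / 2 * half_ratio 1 n
       + (2 * a0 * a3 + 2 * a1 * a2 - (2 * a0 * a2 + a1 * a1)) / 2
         * half_ratio 2 n)).
Proof.
  intros q a0 a1 a2 a3; destruct (gf_bottom_expansion r) as [H [HH E]].
  fold q in E.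
  set (A0 := fconst a0); set (A1 := fconst a1); set (A2 := fconst a2);
    set (A3 := fconst a3).
  (* The coefficients of e^4 to e^7 in (1 - e) p^2, then the terms containing [H]. *)
  set (G := (fconst (/ 2) * (2 * A1 * A3 + A2 * A2 - (2 * A0 * A3 + 2 * A1 * A2)
     + feps * (2 * A2 * A3 - (2 * A1 * A3 + A2 * A2)
     + feps * (A3 * A3 - 2 * A2 * A3 - feps * (A3 * A3)))
     + (1 - feps) * (2 * bottom_poly q * H + feps4 * (H * H))))%fps).
  apply bigO_ext with (N := O) (g := fun n => (half_pow 3 * G)%fps n / gf_all n).
  2:{ apply bigO_half_pow_mul; unfold G.
      assert (small (bottom_poly q)) by apply small_eps_poly.
      subst A0 A1 A2 A3; unfold feps4; prove_small. }
  intros n _; rewrite E_nr_gf, gf_branches_sqr_half, E.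
  assert (E2 : (2 * fX = fconst (/ 2) * (1 - feps))%fps).
  { rewrite <- four_X.
    transitivity ((fconst (/ 2) * 2) * (2 * fX))%fps; [|ring].
    rewrite <- fconst_2, <- fconst_mul, Rinv_l by lra; ring. }
  assert (E3 : (2 * fX * ((bottom_poly q + feps4 * H) * (bottom_poly q + feps4 * H))
      * finv_sqrt_cube
    = fconst (a0 * a0 / 2) * finv_sqrt_cube
      + fconst ((2 * a0 * a1 - a0 * a0) / 2) * half_pow 0
      + fconst ((2 * a0 * a2 + a1 * a1 - 2 * a0 * a1) / 2) * half_pow 1
      + fconst ((2 * a0 * a3 + 2 * a1 * a2 - (2 * a0 * a2 + a1 * a1)) / 2)
        * half_pow 2
      + half_pow 3 * G)%fps).
  { rewrite E2; unfold G, Rdiv.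
    repeat (rewrite ?fconst_add, ?fconst_mul, ?fconst_sub).
    rewrite !fconst_2; fold A0 A1 A2 A3.
    simpl half_pow; rewrite <- feps_finv_sqrt_cube.
    unfold bottom_poly, eps_poly, feps4; fold a0 a1 a2 a3 A0 A1 A2 A3.
    ring. }
  rewrite E3; unfold fadd; rewrite !fmul_const; unfold half_ratio, finv_sqrt_cube.
  field; apply Rgt_not_eq, gf_all_pos.
Qed.

Definition mean_main (q : R) (n : nat) : R :=
  INR n / q + / 6 * (1 + 5 / q) + / (20 * INR n) * (q - / q)
  + / (12 * INR n ^ 2) * (5 * q ^ 2 / 21 - 7 * q / 10 + 97 / (210 * q)).

Lemma mean_expansion r : bigO 3 (fun n => E_nr n r - mean_main (4 ^ r) n).
Proof.
  assert (Hq : 4 ^ r <> 0) by (apply pow_nonzero; lra).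
  set (q := 4 ^ r) in *.
  eapply bigO_ext with (N := 1%nat);
    [|exact (bigO_add _ _ _ (E_nr_expansion r) (bigO_add _ _ _
        (bigO_scal _ (bottom_coef1 q) _ half_ratio_1_expansion) (bigO_add _ _ _
        (bigO_scal _ (bottom_coef2 q) _ half_ratio_2_expansion)
        (bigO_scal _ (bottom_coef3 q) _ half_ratio_3_expansion))))].
  intros n Hn; cbv beta zeta; fold q; rewrite half_ratio_0.
  apply le_INR in Hn; simpl in Hn.
  unfold mean_main, bottom_coef0, bottom_coef1, bottom_coef2, bottom_coef3.
  field; lra.
Qed.

Definition variance_main (q : R) (n : nat) : R :=
  (q - 1) / (3 * q ^ 2) * INR n - (2 * q ^ 2 - 25 * q + 23) / (90 * q ^ 2)
  - (13 * q ^ 3 - 14 * q ^ 2 + 7 * q - 6) / (420 * q ^ 2 * INR n).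

Lemma variance_expansion r : bigO 2 (fun n => V_nr n r - variance_main (4 ^ r) n).
Proof.
  assert (Hq : 4 ^ r <> 0) by (apply pow_nonzero; lra).
  pose proof (mean_expansion r) as HE; pose proof (branches_sqr_expansion r) as HS.
  cbv zeta in HS; set (q := 4 ^ r) in *.
  set (a0 := bottom_coef0 q) in *; set (a1 := bottom_coef1 q) in *;
    set (a2 := bottom_coef2 q) in *; set (a3 := bottom_coef3 q) in *.
  set (b2 := (2 * a0 * a2 + a1 * a1 - 2 * a0 * a1) / 2) in *.
  set (b3 := (2 * a0 * a3 + 2 * a1 * a2 - (2 * a0 * a2 + a1 * a1)) / 2) in *.
  set (d := fun n => E_nr n r - mean_main q n) in *.
  set (l0 := / 6 * (1 + 5 / q)).
  set (l1 := / 20 * (q - / q)).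
  set (l2 := / 12 * (5 * q ^ 2 / 21 - 7 * q / 10 + 97 / (210 * q))).
  (* [E^2 = L^2 + d (2 L + d)] with [L = mean_main = O(n)] and [d = O(n^-3)]. *)
  apply bigO_ext with (N := 1%nat) (g := fun n =>
    (gf_branches_sqr r n / gf_all n
     - (E_nr n r + a0 * a0 / 2 * ((2 * INR n + 1) * (INR n + 1))
        + (2 * a0 * a1 - a0 * a0) / 2 * half_ratio 0 n
        + b2 * half_ratio 1 n + b3 * half_ratio 2 n))
    + b2 * (half_ratio 1 n - (- / 2 - 3 / (4 * INR n) - 3 / (8 * INR n ^ 2)))
    + b3 * (half_ratio 2 n - (3 / (4 * INR n) + 9 / (4 * INR n ^ 2)))
    (* The -1 comes from the summand [E_nr n r] of the second moment. The factor n costs [d] one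
       order, from n^(-3) to n^(-2). *)
    + - ((2 / q * INR n + (2 * l0 - 1)) * d n)
    + (- (2 * l1)) * (/ INR n * d n) + (- (2 * l2)) * (/ INR n ^ 2 * d n)
    + - (d n * d n)
    + (l2 - 2 * l0 * l2 - l1 ^ 2 - 3 / 8 * b2 + 9 / 4 * b3) * / INR n ^ 2
    + (- (2 * l1 * l2)) * / INR n ^ 3 + (- l2 ^ 2) * / INR n ^ 4).
  - intros n Hn; apply le_INR in Hn; simpl in Hn.
    rewrite V_nr_gf.
    replace (E_nr n r) with (mean_main q n + d n) by (unfold d; ring).
    rewrite half_ratio_0.
    generalize (d n) (half_ratio 1 n) (half_ratio 2 n)
      (gf_branches_sqr r n / gf_all n); intros dn h1 h2 s.
    unfold mean_main, variance_main, b2, b3, l0, l1, l2, a0, a1, a2, a3,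
      bottom_coef0, bottom_coef1, bottom_coef2, bottom_coef3.
    (* The terms in n^2 cancel here, since [a0] is also the leading coefficient [/ q] of the
       mean. *)
    field; lra.
  - assert (Hd : bigO 2 d) by now apply bigO_weaken.
    repeat (exact HS || apply bigO_add); try apply bigO_scal; try apply bigO_opp.
    + apply bigO_weaken, half_ratio_1_expansion.
    + apply bigO_weaken, half_ratio_2_expansion.
    + now apply bigO_affine_mul.
    + apply bigO_weaken, (bigO_mul 1 2); [apply bigO_inv|exact Hd].
    + apply bigO_weaken, bigO_weaken, (bigO_mul 2 2);
        [apply bigO_inv_pow|exact Hd].
    + apply bigO_weaken, bigO_weaken, (bigO_mul 2 2); exact Hd.
    + apply bigO_inv_pow.
    + apply bigO_weaken, bigO_inv_pow.
    + apply bigO_weaken, bigO_weaken, bigO_inv_pow.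
Qed.

Theorem theorem1 (r : nat) :
  (exists C : R, exists N : nat, forall n : nat, (N <= n)%nat ->
     Rabs (E_nr n r
           - ( INR n / 4 ^ r
             + / 6 * (1 + 5 / 4 ^ r)
             + / (20 * INR n) * (4 ^ r - / 4 ^ r)
             + / (12 * INR n ^ 2)
                 * (5 * 16 ^ r / 21 - 7 * 4 ^ r / 10 + 97 / (210 * 4 ^ r))))
       <= C / INR n ^ 3)
  /\
  (exists C : R, exists N : nat, forall n : nat, (N <= n)%nat ->
     Rabs (V_nr n r
           - ( (4 ^ r - 1) / (3 * 16 ^ r) * INR n
             - (2 * 16 ^ r - 25 * 4 ^ r + 23) / (90 * 16 ^ r)
             - (13 * 64 ^ r - 14 * 16 ^ r + 7 * 4 ^ r - 6) / (420 * 16 ^ r * INR n)))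
       <= C / INR n ^ 2).
Proof.
  replace (16 ^ r) with ((4 ^ r) ^ 2)
    by (rewrite <- pow_mult, Nat.mul_comm, pow_mult; f_equal; ring).
  replace (64 ^ r) with ((4 ^ r) ^ 3)
    by (rewrite <- pow_mult, Nat.mul_comm, pow_mult; f_equal; ring).
  split; [exact (mean_expansion r)|exact (variance_expansion r)].
Qed.
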